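(* Let $R$ be a commutative Noetherian ring and let $A$ be a projective Noetherian $R$-algebra. Let $Q\in A\text{-mod}\cap R\text{-proj}$ have a base change property, and let $M\in A\text{-mod}\cap R\text{-proj}$ satisfy: (1) $\operatorname{Hom}_A(M,Q)\in R\text{-proj}$; (2) the canonical map $R(\mathfrak m)\otimes_R\operatorname{Hom}_A(M,Q)\to\operatorname{Hom}_{A(\mathfrak m)}(M(\mathfrak m),Q(\mathfrak m))$ is an isomorphism for every maximal ideal $\mathfrak m$ of $R$. Then $$Q\text{-}\operatorname{domdim}_{(A,R)}M=\inf\{Q(\mathfrak m)\text{-}\operatorname{domdim}_{A(\mathfrak m)}M(\mathfrak m)\colon \mathfrak m\in\operatorname{MaxSpec}(R)\}.$$
   Context: A projective Noetherian $R$-algebra is an $R$-algebra that is finitely generated and projective as an $R$-module. $A\text{-mod}$ is the category of finitely generated left $A$-modules and $R\text{-proj}$ the category of finitely generated projective $R$-modules. For a maximal ideal $\mathfrak m$ of $R$, $R(\mathfrak m)=R/\mathfrak m$, $A(\mathfrak m)=R(\mathfrak m)\otimes_R A$ and $M(\mathfrak m)=R(\mathfrak m)\otimes_R M$; $\operatorname{MaxSpec}(R)$ is the set of maximal ideals. For a module $T$, $\operatorname{add}T$ is the full subcategory of direct summands of finite direct sums of copies of $T$. A module $Q\in A\text{-mod}\cap R\text{-proj}$ has a base change property if $\operatorname{Hom}_A(Q,Q)\in R\text{-proj}$ and for every commutative $R$-algebra $S$ which is a Noetherian ring, the canonical map $S\otimes_R\operatorname{Hom}_A(Q,Q)\to\operatorname{Hom}_{S\otimes_R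 A}(S\otimes_R Q,S\otimes_R Q)$ is an isomorphism. An exact sequence of $A$-modules is $(A,R)$-exact if it splits as a sequence of $R$-modules; an $(A,R)$-monomorphism is an $A$-homomorphism $f\colon M\to N$ such that $0\to M\xrightarrow{f}N$ is $(A,R)$-exact (i.e. $f$ is split injective over $R$). A left $\operatorname{add}T$-approximation of $X$ is an $A$-homomorphism $X\to N$ with $N\in\operatorname{add}T$ such that $\operatorname{Hom}_A(N,Y)\to\operatorname{Hom}_A(X,Y)$ is surjective for all $Y\in\operatorname{add}T$. For $T,X\in A\text{-mod}\cap R\text{-proj}$, if $X$ admits no left $\operatorname{add}T$-approximation which is an $(A,R)$-monomorphism then $T\text{-}\operatorname{domdim}_{(A,R)}X=0$. Otherwise $T\text{-}\operatorname{domdim}_{(A,R)}X\in\mathbb N\cup\{+\infty\}$ is the supremum of all $n\in\mathbb N$ such that there is an $(A,R)$-exact sequence $0\to X\to T_1\to\cdots\to T_n$ with all $T_i\in\operatorname{add}T$ which remains exact under $\operatorname{Hom}_A(-,T)$, i.e. $\operatorname{Hom}_A(T_n,T)\to\cdots\to\operatorname{Hom}_A(T_1,T)\to\operatorname{Hom}_A(X,T)\to 0$ is exact. When the ground ring is a field one writes $T\text{-}\operatorname{domdim}_A X$. *)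

(* Defs.v *)
From HB Require Import structures.
From mathcomp Require Import all_boot all_order all_algebra.
From mathcomp Require Import boolp classical_sets constructive_ereal freeg.

Set Implicit Arguments.
Unset Strict Implicit.
Unset Printing Implicit Defensive.

Import Order.TTheory GRing.Theory.

Local Open Scope ring_scope.
Local Open Scope classical_set_scope.
Local Open Scope quotient_scope.

(* Rings and algebras are [pzRingType]s: the zero ring has to be allowed,     *)
(* since S (x)_R A can vanish even when S and A do not. This rules out the    *)
(* library's [algType], whose carrier is a nontrivial ring.                   *)

Record algebra (R : comPzRingType) := Algebra {
  alg_ring :> pzRingType;
  alg_map : {rmorphism R -> alg_ring};
  alg_central : forall r a, alg_map r * a = a * alg_map r }.

Arguments alg_map {R} a : rename.

Definition res (R : comPzRingType) (A : algebra R) (M : lmodType A) : Type := M.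

Section Res.
Variables (R : comPzRingType) (A : algebra R) (M : lmodType A).

HB.instance Definition _ := GRing.Zmodule.copy (res M) M.

Definition res_scale (r : R) (x : res M) : res M := alg_map A r *: (x : M).

Fact res_scaleA r s x : res_scale r (res_scale s x) = res_scale (r * s) x.
Proof. by rewrite /res_scale scalerA rmorphM. Qed.

Fact res_scale1 : left_id 1 res_scale.
Proof. by move=> x; rewrite /res_scale rmorph1 scale1r. Qed.

Fact res_scaleDr : right_distributive res_scale +%R.
Proof. by move=> r x y; exact: scalerDr. Qed.

Fact res_scaleDl x : {morph res_scale^~ x : r s / r + s}.
Proof. by move=> r s; rewrite /res_scale rmorphD scalerDl. Qed.

HB.instance Definition _ := GRing.Zmodule_isLmodule.Build R (res M)
  res_scaleA res_scale1 res_scaleDr res_scaleDl.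

Lemma res_scaleE r (x : res M) : r *: x = alg_map A r *: (x : M).
Proof. by []. Qed.
End Res.

Definition fin_gen (R : pzRingType) (M : lmodType R) : Prop :=
  exists (n : nat) (g : 'I_n -> M),
    forall x, exists c : 'I_n -> R, x = \sum_(i < n) c i *: g i.

Definition projective (R : pzRingType) (P : lmodType R) : Prop :=
  forall (M N : lmodType R) (g : {linear M -> N}) (f : {linear P -> N}),
    (forall y, exists x, g x = y) ->
    exists h : {linear P -> M}, forall x, g (h x) = f x.

Definition fgproj (R : pzRingType) (P : lmodType R) : Prop :=
  fin_gen P /\ projective P.

Record ideal (R : comPzRingType) := Ideal {
  ideal_set :> R -> Prop;
  ideal0 : ideal_set 0;
  idealD : forall x y, ideal_set x -> ideal_set y -> ideal_set (x + y);
  idealM : forall r x, ideal_set x -> ideal_set (r * x) }.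

Definition noetherian (R : comPzRingType) : Prop :=
  forall I : ideal R, exists (n : nat) (g : 'I_n -> R),
    forall x, I x <-> exists c : 'I_n -> R, x = \sum_(i < n) c i * g i.

Definition maxspec (R : comPzRingType) : set (ideal R) :=
  [set m : ideal R | ~ m 1 /\
    forall J : ideal R, (forall x, m x -> J x) -> ~ J 1 ->
      forall x, J x -> m x].

Arguments maxspec R : clear implicits.

Definition is_subgroup (V : zmodType) (H : set V) : Prop :=
  H 0 /\ forall x y, H x -> H y -> H (x - y).

Record subgroup (V : zmodType) := Subgroup {
  subgroup_set :> V -> Prop;
  subgroupP : is_subgroup subgroup_set }.

Section Quotg.
Variables (V : zmodType) (H : subgroup V).

Definition subgroup_mem : {pred V} := fun x => `[< H x >].

Fact subgroup_mem_closed : zmod_closed subgroup_mem.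
Proof.
have [H0 HB] := subgroupP H.
split=> [|x y /asboolP Hx /asboolP Hy]; first exact/asboolP.
exact/asboolP/HB.
Qed.

HB.instance Definition _ := GRing.isZmodClosed.Build V subgroup_mem
  subgroup_mem_closed.

Definition quotg : Type := Quotient.quot subgroup_mem.

HB.instance Definition _ := GRing.Zmodule.on quotg.

Definition quotg_pi (x : V) : quotg := \pi_(Quotient.quot subgroup_mem) x.

Fact quotg_pi_additive : zmod_morphism quotg_pi.
Proof. by move=> x y; rewrite /quotg_pi !piE. Qed.

HB.instance Definition _ := GRing.isZmodMorphism.Build V quotg quotg_pi
  quotg_pi_additive.

Lemma quotg_piP (x y : V) : quotg_pi x = quotg_pi y <-> H (x - y).
Proof.
rewrite /quotg_pi; split=> [/eqP|Hxy]; last apply/eqP;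
  rewrite -Quotient.idealrBE; last exact/asboolP.
by move/asboolP.
Qed.

Lemma quotg_pi_surj (y : quotg) : exists x, quotg_pi x = y.
Proof. by exists (repr (y : Quotient.quot _)); rewrite /quotg_pi reprK. Qed.

Definition quotg_lift (W : zmodType) (f : V -> W) (x : quotg) : W :=
  f (repr (x : Quotient.quot subgroup_mem)).

Lemma quotg_liftE (W : zmodType) (f : {additive V -> W}) :
  (forall x, H x -> f x = 0) -> forall x, quotg_lift f (quotg_pi x) = f x.
Proof.
move=> fH x; apply/eqP; rewrite -subr_eq0 -raddfB; apply/eqP/fH.
by apply/quotg_piP; rewrite /quotg_pi reprK.
Qed.
End Quotg.

Section Rquot.
Variables (R : comPzRingType) (I : ideal R).

Fact ideal_is_subgroup : is_subgroup I.
Proof.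
split=> [|x y Ix Iy]; first exact: ideal0.
by apply: idealD => //; rewrite -mulN1r; apply: idealM.
Qed.

Definition rquot : Type := quotg (Subgroup ideal_is_subgroup).

HB.instance Definition _ := GRing.Zmodule.on rquot.

Definition rquot_pi (x : R) : rquot := quotg_pi (Subgroup ideal_is_subgroup) x.

Fact rquot_pi_additive : zmod_morphism rquot_pi.
Proof. exact: raddfB. Qed.

HB.instance Definition _ := GRing.isZmodMorphism.Build R rquot rquot_pi
  rquot_pi_additive.

Definition rquot_repr (x : rquot) : R :=
  repr (x : Quotient.quot (subgroup_mem (Subgroup ideal_is_subgroup))).

Fact rquot_reprK x : rquot_pi (rquot_repr x) = x.
Proof. by rewrite /rquot_pi /quotg_pi reprK. Qed.

Lemma rquot_piP (x y : R) : rquot_pi x = rquot_pi y <-> I (x - y).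
Proof. exact: quotg_piP. Qed.

Definition rquot_one : rquot := rquot_pi 1.
Definition rquot_mul (x y : rquot) : rquot :=
  rquot_pi (rquot_repr x * rquot_repr y).

Fact rquot_piM x y : rquot_mul (rquot_pi x) (rquot_pi y) = rquot_pi (x * y).
Proof.
apply/rquot_piP; set a := rquot_repr _; set b := rquot_repr _.
have Ia : I (a - x) by apply/rquot_piP; rewrite rquot_reprK.
have Ib : I (b - y) by apply/rquot_piP; rewrite rquot_reprK.
have -> : a * b - x * y = b * (a - x) + x * (b - y).
  by rewrite !mulrBr [b * a]mulrC [b * x]mulrC addrA subrK.
by apply: idealD; apply: idealM.
Qed.

Fact rquot_mulA : associative rquot_mul.
Proof.
move=> x y z; rewrite -[x]rquot_reprK -[y]rquot_reprK -[z]rquot_reprK.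
by rewrite !rquot_piM mulrA.
Qed.

Fact rquot_mulC : commutative rquot_mul.
Proof.
by move=> x y; rewrite -[x]rquot_reprK -[y]rquot_reprK !rquot_piM mulrC.
Qed.

Fact rquot_mul1 : left_id rquot_one rquot_mul.
Proof. by move=> x; rewrite -[x]rquot_reprK rquot_piM mul1r. Qed.

Fact rquot_mulDl : left_distributive rquot_mul +%R.
Proof.
move=> x y z; rewrite -[x]rquot_reprK -[y]rquot_reprK -[z]rquot_reprK.
by rewrite -raddfD !rquot_piM mulrDl raddfD.
Qed.

HB.instance Definition _ := GRing.Zmodule_isComPzRing.Build rquot
  rquot_mulA rquot_mulC rquot_mul1 rquot_mulDl.

Fact rquot_pi_monoid_morphism : monoid_morphism rquot_pi.
Proof. by split=> // x y; rewrite -[RHS]/(rquot_mul _ _) rquot_piM. Qed.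

HB.instance Definition _ := GRing.isMonoidMorphism.Build R rquot rquot_pi
  rquot_pi_monoid_morphism.
End Rquot.

Lemma zmorph0 (V W : zmodType) (f : V -> W) : zmod_morphism f -> f 0 = 0.
Proof. by move=> fB; rewrite -[X in f X](subrr 0) fB subrr. Qed.

Lemma zmorphD (V W : zmodType) (f : V -> W) :
  zmod_morphism f -> {morph f : x y / x + y}.
Proof.
move=> fB x y; rewrite -[y in LHS]opprK fB -[- y]sub0r fB (zmorph0 fB).
by rewrite sub0r opprK.
Qed.

Section BaseChange.
Variables (R S : comPzRingType) (phi : {rmorphism R -> S}) (M : lmodType R).

Let free := {freeg (S * M)%type / int}.
Let gen (s : S) (m : M) : free := << (s, m) >>.

Inductive bc_rel : free -> Prop :=
| Bc_addl s s' m : bc_rel (gen (s + s') m - (gen s m + gen s' m))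
| Bc_addr s m m' : bc_rel (gen s (m + m') - (gen s m + gen s m'))
| Bc_bal s r m : bc_rel (gen (s * phi r) m - gen s (r *: m)).

Definition bc_ker : set free := smallest (@is_subgroup free) bc_rel.

Fact bc_ker_subgroup : is_subgroup bc_ker.
Proof.
split=> [H [[H0 _] _] //|x y Hx Hy H HH]; have [[_ HB] _] := HH.
by apply: HB; [apply: Hx | apply: Hy].
Qed.

(* S (x)_R M, where S is an R-algebra through phi: the free abelian group on  *)
(* S x M modulo the subgroup generated by [bc_rel].                           *)
Definition bc : Type := quotg (Subgroup bc_ker_subgroup).

HB.instance Definition _ := GRing.Zmodule.on bc.

Definition pure (s : S) (m : M) : bc :=
  quotg_pi (Subgroup bc_ker_subgroup) (gen s m).

Definition balanced (W : zmodType) (b : S -> M -> W) : Prop :=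
  [/\ forall s s' m, b (s + s') m = b s m + b s' m,
      forall s m m', b s (m + m') = b s m + b s m'
    & forall s r m, b (s * phi r) m = b s (r *: m)].

Fact pure_balanced : balanced pure.
Proof.
have kerE x : bc_rel x -> bc_ker x by move=> relx H [_ relH]; exact: relH.
by split=> *; rewrite /pure -?raddfD; apply/quotg_piP; apply: kerE; constructor.
Qed.

(* Meaningful for balanced b only, see [bc_liftE] and [bc_lift_additive]. *)
Definition bc_lift (W : zmodType) (b : S -> M -> W) : bc -> W :=
  quotg_lift (fglift (fun sm => b sm.1 sm.2 : zmodule W) : free -> W).

Section Lift.
Variables (W : zmodType) (b : S -> M -> W).
Hypothesis bP : balanced b.

Let f : free -> W := fglift (fun sm => b sm.1 sm.2 : zmodule W).

Let fD : zmod_morphism f.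
Proof.
by move=> x y; exact: (@lift_is_additive int (S * M)%type (zmodule W)).
Qed.

HB.instance Definition _ := GRing.isZmodMorphism.Build free W f fD.

Let fE s m : f (gen s m) = b s m.
Proof. by rewrite /f liftU scale1r. Qed.

Let f_ker x : bc_ker x -> f x = 0.
Proof.
move/(_ [set x | f x = 0]); apply; split=> [|y []].
- by split=> [|y z /= fy fz]; rewrite /= ?raddf0 // raddfB /= fy fz subr0.
- move=> s s' m /=; rewrite raddfB raddfD /= !fE.
  by case: bP => ->; rewrite subrr.
- move=> s m m' /=; rewrite raddfB raddfD /= !fE.
  by case: bP => _ ->; rewrite subrr.
- by move=> s r m /=; rewrite raddfB /= !fE; case: bP => _ _ ->; rewrite subrr.
Qed.

Let liftE y : bc_lift b (quotg_pi (Subgroup bc_ker_subgroup) y) = f y.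
Proof. exact: (quotg_liftE (H := Subgroup bc_ker_subgroup) (f := f)). Qed.

Lemma bc_liftE s m : bc_lift b (pure s m) = b s m.
Proof. by rewrite liftE fE. Qed.

Lemma bc_lift_additive : zmod_morphism (bc_lift b).
Proof.
move=> x y; have [x' <-] := quotg_pi_surj x; have [y' <-] := quotg_pi_surj y.
by rewrite -raddfB !liftE raddfB.
Qed.
End Lift.

Lemma bc_ind (P : bc -> Prop) :
  P 0 -> (forall x y, P x -> P y -> P (x + y)) ->
  (forall s m, P (pure s m)) -> forall x, P x.
Proof.
move=> P0 PD Pp x; have [y <-] := quotg_pi_surj x.
have pureN s m : pure (- s) m = - pure s m.
  have [pD _ _] := pure_balanced; apply/eqP; rewrite -addr_eq0 -pD addNr.
  by rewrite -(addrK (pure 0 m) (pure 0 m)) -pD addr0 subrr.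
have Pn n z : P z -> P (z *+ n).
  by move=> Pz; elim: n => [|n IHn]; rewrite ?mulr0n // mulrS; apply: PD.
rewrite -[y]freeg_sumE raddf_sum; elim/big_ind: _ => // -[s m] _.
rewrite -[coeff _ _]intz -freegU_mulz raddfMz -/(pure s m).
case: (coeff _ _) => n; first exact/Pn/Pp.
by rewrite NegzE mulrNz -mulNrz -pureN; exact/Pn/Pp.
Qed.

Lemma bc_eq (W : zmodType) (f g : bc -> W) :
  zmod_morphism f -> zmod_morphism g ->
  (forall s m, f (pure s m) = g (pure s m)) -> f =1 g.
Proof.
move=> fB gB fg; apply: bc_ind => [|x y fx fy|//]; first by rewrite !zmorph0.
by rewrite !zmorphD // fx fy.
Qed.

Lemma pureDl s s' m : pure (s + s') m = pure s m + pure s' m.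
Proof. by case: pure_balanced. Qed.

Lemma pureDr s m m' : pure s (m + m') = pure s m + pure s m'.
Proof. by case: pure_balanced. Qed.

Lemma pure_bal s r m : pure (s * phi r) m = pure s (r *: m).
Proof. by case: pure_balanced. Qed.

Definition bc_scale (s : S) : bc -> bc :=
  bc_lift (fun s' m => pure (s * s') m).

Fact bc_scale_balanced s : balanced (fun s' m => pure (s * s') m).
Proof.
by split=> *; rewrite ?mulrDr ?pureDl ?pureDr // mulrA pure_bal.
Qed.

Lemma bc_scaleE s s' m : bc_scale s (pure s' m) = pure (s * s') m.
Proof. exact/bc_liftE/bc_scale_balanced. Qed.

Fact bc_scaleB s : zmod_morphism (bc_scale s).
Proof. exact/bc_lift_additive/bc_scale_balanced. Qed.

HB.instance Definition _ s := GRing.isZmodMorphism.Build bc bc (bc_scale s)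
  (bc_scaleB s).

Fact bc_scaleA s t x : bc_scale s (bc_scale t x) = bc_scale (s * t) x.
Proof.
elim/bc_ind: x => [|x y IHx IHy|s' m]; first by rewrite !raddf0.
  by rewrite !raddfD /= IHx IHy.
by rewrite !bc_scaleE mulrA.
Qed.

Fact bc_scale1 : left_id 1 bc_scale.
Proof.
elim/bc_ind=> [|x y IHx IHy|s m]; first by rewrite raddf0.
  by rewrite !raddfD /= IHx IHy.
by rewrite bc_scaleE mul1r.
Qed.

Fact bc_scaleDr : right_distributive bc_scale +%R.
Proof. by move=> s; apply: raddfD. Qed.

Fact bc_scaleDl x : {morph bc_scale^~ x : s t / s + t}.
Proof.
move=> s t; elim/bc_ind: x => [|x y IHx IHy|s' m].
  by rewrite !raddf0 addr0.
  by rewrite !raddfD /= IHx IHy addrACA.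
by rewrite !bc_scaleE mulrDl pureDl.
Qed.

HB.instance Definition _ := GRing.Zmodule_isLmodule.Build S bc
  bc_scaleA bc_scale1 bc_scaleDr bc_scaleDl.

Lemma bc_scale_pure s s' m : s *: pure s' m = pure (s * s') m.
Proof. exact: bc_scaleE. Qed.
End BaseChange.

Arguments pure {R S} phi {M} s m.

Definition reg (R : comPzRingType) (A : algebra R) : lmodType R := res A^o.

Section BaseChangeAct.
Variables (R S : comPzRingType) (phi : {rmorphism R -> S}) (A : algebra R).

(* (s (x) a) (s' (x) m) = s s' (x) a m, the common source of the product of   *)
(* S (x)_R A and of its action on S (x)_R M.                                  *)
Definition bc_act (M : lmodType A) (x : bc phi (reg A)) (y : bc phi (res M)) :
    bc phi (res M) :=
  bc_lift (fun (s : S) (a : reg A) =>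
    bc_lift (fun (s' : S) (m : res M) =>
      pure phi (s * s') ((a : A) *: (m : M) : res M)) y) x.

Section Act.
Variable M : lmodType A.
Local Notation act := (@bc_act M).
Local Notation act1 s a := (fun (s' : S) (m : res M) =>
  pure phi (s * s') ((a : A) *: (m : M) : res M)).

Fact bc_act1_balanced s (a : reg A) : balanced phi (act1 s a).
Proof.
split=> [s1 s2 m|s1 m m'|s1 r m]; first by rewrite mulrDr pureDl.
  by rewrite -pureDr; congr (pure _ _ _); exact: (@scalerDr A M).
by rewrite mulrA pure_bal !res_scaleE !scalerA alg_central.
Qed.

Fact bc_act2_balanced (y : bc phi (res M)) :
  balanced phi (fun (s : S) (a : reg A) => bc_lift (act1 s a) y).
Proof.
have lB s a := bc_lift_additive (bc_act1_balanced s a).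
have l0 s a := zmorph0 (lB s a); have lD s a := zmorphD (lB s a).
have lE s a := bc_liftE (bc_act1_balanced s a).
split=> [s s' a|s a a'|s r a].
- elim/bc_ind: y => [|y y' IH IH'|t m]; first by rewrite !l0 addr0.
    by rewrite !lD IH IH' addrACA.
  by rewrite !lE mulrDl pureDl.
- elim/bc_ind: y => [|y y' IH IH'|t m]; first by rewrite !l0 addr0.
    by rewrite !lD IH IH' addrACA.
  by rewrite !lE -pureDr; congr (pure _ _ _); exact: (@scalerDl A M).
elim/bc_ind: y => [|y y' IH IH'|t m]; first by rewrite !l0.
  by rewrite !lD IH IH'.
rewrite !lE mulrAC pure_bal; congr (pure _ _ _).
exact: (@scalerA A M).
Qed.

Lemma bc_actE s a s' m :
  act (pure phi s a) (pure phi s' m) =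
  pure phi (s * s') ((a : A) *: (m : M) : res M).
Proof.
rewrite /bc_act (bc_liftE (bc_act2_balanced _)).
exact: bc_liftE (bc_act1_balanced s a) _ _.
Qed.

Fact bc_actBl y : zmod_morphism (act^~ y).
Proof. exact/bc_lift_additive/bc_act2_balanced. Qed.

Fact bc_actBr x : zmod_morphism (act x).
Proof.
move=> y y'; elim/bc_ind: x => [|x x' IH IH'|s a].
- by rewrite !(zmorph0 (bc_actBl _)) subr0.
- by rewrite !(zmorphD (bc_actBl _)) IH IH' opprD addrACA.
rewrite /bc_act !(bc_liftE (bc_act2_balanced _)).
exact: bc_lift_additive (bc_act1_balanced s a) _ _.
Qed.

Fact bc_act1 y : act (pure phi 1 ((1 : A) : reg A)) y = y.
Proof.
elim/bc_ind: y => [|y y' IH IH'|s m]; first exact: zmorph0 (bc_actBr _).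
  by rewrite (zmorphD (bc_actBr _)) IH IH'.
by rewrite bc_actE mul1r; congr (pure _ _ _); exact: (@scale1r A M).
Qed.
End Act.

Fact bc_actA (M : lmodType A) x x' (y : bc phi (res M)) :
  bc_act x (bc_act x' y) = bc_act (bc_act (M := A^o) x x') y.
Proof.
elim/bc_ind: x => [|x1 x2 IH1 IH2|s a].
- by rewrite !(zmorph0 (bc_actBl _)).
- by rewrite !(zmorphD (bc_actBl _)) IH1 IH2.
elim/bc_ind: x' => [|x1 x2 IH1 IH2|s' a'].
- rewrite (zmorph0 (bc_actBr _)) !(zmorph0 (bc_actBl _)).
  by rewrite (zmorph0 (bc_actBr _)).
- rewrite (zmorphD (bc_actBr _)) !(zmorphD (bc_actBl _)) (zmorphD (bc_actBr _)).
  by rewrite IH1 IH2.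
elim/bc_ind: y => [|y1 y2 IH1 IH2|t m].
- by rewrite !(zmorph0 (bc_actBr _)).
- by rewrite !(zmorphD (bc_actBr _)) IH1 IH2.
rewrite !bc_actE mulrA; congr (pure _ _ _).
exact: (@scalerA A M).
Qed.

Definition bc_ring : Type := bc phi (reg A).

HB.instance Definition _ := GRing.Zmodule.on bc_ring.

Definition bc_one : bc_ring := pure phi 1 ((1 : A) : reg A).
Definition bc_mul (x y : bc_ring) : bc_ring := bc_act (M := A^o) x y.

Fact bc_mulA : associative bc_mul.
Proof. exact: (@bc_actA A^o). Qed.

Fact bc_mul1 : left_id bc_one bc_mul.
Proof. exact: (@bc_act1 A^o). Qed.

Fact bc_1mul : right_id bc_one bc_mul.
Proof.
elim/bc_ind=> [|x y IHx IHy|s a]; first exact: zmorph0 (bc_actBl _).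
  by rewrite /bc_mul (zmorphD (bc_actBl _)); congr (_ + _).
rewrite /bc_mul bc_actE mulr1; congr (pure _ _ _).
exact: (@mulr1 A).
Qed.

Fact bc_mulDl : left_distributive bc_mul +%R.
Proof. by move=> x y z; exact: zmorphD (bc_actBl _) _ _. Qed.

Fact bc_mulDr : right_distributive bc_mul +%R.
Proof. by move=> x y z; exact: zmorphD (bc_actBr _) _ _. Qed.

HB.instance Definition _ := GRing.Zmodule_isPzRing.Build bc_ring
  bc_mulA bc_mul1 bc_1mul bc_mulDl bc_mulDr.

Definition bc_str (s : S) : bc_ring := pure phi s ((1 : A) : reg A).

Fact bc_strB : zmod_morphism bc_str.
Proof.
by move=> s t; apply/eqP; rewrite eq_sym subr_eq -[_ + _]pureDl subrK.
Qed.

Fact bc_strM : monoid_morphism bc_str.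
Proof.
split=> // s t; rewrite -[RHS]/(bc_mul _ _) /bc_mul bc_actE.
by congr (pure _ _ _); rewrite -[RHS]/(1 * 1 : A) mul1r.
Qed.

HB.instance Definition _ := GRing.isZmodMorphism.Build S bc_ring bc_str bc_strB.
HB.instance Definition _ :=
  GRing.isMonoidMorphism.Build S bc_ring bc_str bc_strM.

Fact bc_central s (x : bc_ring) : bc_str s * x = x * bc_str s.
Proof.
rewrite -[LHS]/(bc_mul _ _) -[RHS]/(bc_mul _ _) /bc_mul.
elim/bc_ind: x => [|x y IHx IHy|t a].
- by rewrite (zmorph0 (bc_actBl _)) (zmorph0 (bc_actBr _)).
- by rewrite (zmorphD (bc_actBl _)) (zmorphD (bc_actBr _)) IHx IHy.
rewrite /bc_str !bc_actE mulrC; congr (pure _ _ _).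
by rewrite -[LHS]/(1 * (a : A)) -[RHS]/((a : A) * 1) mul1r mulr1.
Qed.

Definition bc_alg : algebra S := @Algebra S bc_ring bc_str bc_central.

(* Same carrier as [bc phi (res M)], which is only an S-module. *)
Definition bc_mod (M : lmodType A) : Type := bc phi (res M).

Section Mod.
Variable M : lmodType A.

HB.instance Definition _ := GRing.Zmodule.on (bc_mod M).

Definition bc_mod_scale (x : bc_ring) (y : bc_mod M) : bc_mod M := bc_act x y.

Fact bc_mod_scaleA x x' y :
  bc_mod_scale x (bc_mod_scale x' y) = bc_mod_scale (x * x') y.
Proof. exact: bc_actA. Qed.

Fact bc_mod_scale1 : left_id 1 bc_mod_scale.
Proof. exact: bc_act1. Qed.

Fact bc_mod_scaleDr : right_distributive bc_mod_scale +%R.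
Proof. by move=> x; exact: zmorphD (bc_actBr _). Qed.

Fact bc_mod_scaleDl y : {morph bc_mod_scale^~ y : x x' / x + x'}.
Proof. exact: zmorphD (bc_actBl _). Qed.

HB.instance Definition _ := GRing.Zmodule_isLmodule.Build bc_ring (bc_mod M)
  bc_mod_scaleA bc_mod_scale1 bc_mod_scaleDr bc_mod_scaleDl.

Lemma bc_mod_scaleE s (a : A) s' (m : M) :
  (pure phi s (a : reg A) : bc_ring) *: (pure phi s' (m : res M) : bc_mod M) =
  pure phi (s * s') (a *: m : res M).
Proof. exact: bc_actE. Qed.
End Mod.
End BaseChangeAct.

Definition modhom (R : comPzRingType) (A : algebra R) (M N : lmodType A) :
    Type :=
  {linear M -> N}.

Section Hom.
Variables (R : comPzRingType) (A : algebra R) (M N : lmodType A).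
Local Notation H := (modhom M N).

HB.instance Definition _ := gen_eqMixin H.
HB.instance Definition _ := gen_choiceMixin H.

Definition modhom_fun (f : H) : {linear M -> N} := f.

Lemma modhomP (f g : H) : modhom_fun f =1 modhom_fun g -> f = g.
Proof.
case: f g => [f cf] [g cg] /= fg.
have E : f = g := funext fg.
case: _ / E in cg fg *; congr (GRing.Linear.Pack _).
case: cf cg => [[a1] [a2]] [[b1] [b2]]; congr (GRing.Linear.Class _ _);
  by congr (_ _); exact: Prop_irrelevance.
Qed.

Definition modhom_zero : H := (\0 : M -> N).
Definition modhom_opp (f : H) : H := \- modhom_fun f.
Definition modhom_add (f g : H) : H := modhom_fun f \+ modhom_fun g.

Fact modhom_addA : associative modhom_add.
Proof. by move=> f g h; apply: modhomP => x /=; rewrite addrA. Qed.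
Fact modhom_addC : commutative modhom_add.
Proof. by move=> f g; apply: modhomP => x /=; rewrite addrC. Qed.
Fact modhom_add0 : left_id modhom_zero modhom_add.
Proof. by move=> f; apply: modhomP => x /=; rewrite add0r. Qed.
Fact modhom_addN : left_inverse modhom_zero modhom_opp modhom_add.
Proof. by move=> f; apply: modhomP => x /=; rewrite addNr. Qed.

HB.instance Definition _ := GRing.isZmodule.Build H
  modhom_addA modhom_addC modhom_add0 modhom_addN.

Definition modhom_scale_fun (r : R) (f : H) (x : M) : N :=
  alg_map A r *: modhom_fun f x.

Fact modhom_scale_linear r f : linear (modhom_scale_fun r f).
Proof.
move=> a x y; rewrite /modhom_scale_fun linearP scalerDr !scalerA.
by rewrite alg_central.
Qed.

Definition modhom_scale (r : R) (f : H) : H :=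
  HB.pack_for {linear M -> N} (modhom_scale_fun r f)
    (GRing.isLinear.Build A M N *:%R (modhom_scale_fun r f)
       (modhom_scale_linear r f)).

Fact modhom_scaleA r s f :
  modhom_scale r (modhom_scale s f) = modhom_scale (r * s) f.
Proof.
apply: modhomP => x /=; rewrite /modhom_scale_fun /= /modhom_scale_fun.
by rewrite scalerA rmorphM.
Qed.
Fact modhom_scale1 : left_id 1 modhom_scale.
Proof.
by move=> f; apply: modhomP => x; rewrite /= /modhom_scale_fun rmorph1 scale1r.
Qed.
Fact modhom_scaleDr : right_distributive modhom_scale +%R.
Proof.
by move=> r f g; apply: modhomP => x; rewrite /= /modhom_scale_fun -scalerDr.
Qed.
Fact modhom_scaleDl f : {morph modhom_scale^~ f : r s / r + s}.
Proof.
move=> r s; apply: modhomP => x.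
by rewrite /= /modhom_scale_fun rmorphD scalerDl.
Qed.

HB.instance Definition _ := GRing.Zmodule_isLmodule.Build R H
  modhom_scaleA modhom_scale1 modhom_scaleDr modhom_scaleDl.
End Hom.

Section BaseChangeHom.
Variables (R S : comPzRingType) (phi : {rmorphism R -> S}) (A : algebra R).
Variables (M N : lmodType A).

Definition bc_map_fun (f : modhom M N) : bc_mod phi M -> bc_mod phi N :=
  bc_lift (fun (s : S) (m : res M) => pure phi s (modhom_fun f m : res N)).

Fact bc_map_balanced (f : modhom M N) :
  balanced phi (fun (s : S) (m : res M) => pure phi s (modhom_fun f m : res N)).
Proof.
split=> [s s' m|s m m'|s r m]; first exact: pureDl.
  by rewrite -pureDr; congr (pure _ _ _); exact: (raddfD (modhom_fun f)).
rewrite pure_bal; congr (pure _ _ _); apply/esym.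
exact: (linearZ_LR (modhom_fun f) (alg_map A r) m).
Qed.

Lemma bc_map_funE f s m :
  bc_map_fun f (pure phi s m) = pure phi s (modhom_fun f m : res N).
Proof. exact: bc_liftE (bc_map_balanced f) _ _. Qed.

Fact bc_map_funB f : zmod_morphism (bc_map_fun f).
Proof. exact: bc_lift_additive (bc_map_balanced f). Qed.

Fact bc_map_linear f : linear (bc_map_fun f : bc_mod phi M -> bc_mod phi N).
Proof.
move=> x y y'; rewrite (zmorphD (bc_map_funB f)); congr (_ + _).
rewrite -[_ *: _]/(bc_act x y) -[RHS]/(bc_act x (bc_map_fun f y)).
elim/bc_ind: x => [|x1 x2 IH1 IH2|s a].
- by rewrite !(zmorph0 (bc_actBl _)) (zmorph0 (bc_map_funB f)).
- by rewrite !(zmorphD (bc_actBl _)) (zmorphD (bc_map_funB f)) IH1 IH2.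
elim/bc_ind: y => [|y1 y2 IH1 IH2|t m].
- by rewrite !(zmorph0 (bc_actBr _), zmorph0 (bc_map_funB f)).
- rewrite (zmorphD (bc_actBr _)) !(zmorphD (bc_map_funB f)).
  by rewrite (zmorphD (bc_actBr _)) IH1 IH2.
rewrite bc_actE !bc_map_funE bc_actE; congr (pure _ _ _).
exact: (linearZ_LR (modhom_fun f) a m).
Qed.

Definition bc_map (f : modhom M N) :
    @modhom S (bc_alg phi A) (bc_mod phi M) (bc_mod phi N) :=
  HB.pack_for {linear bc_mod phi M -> bc_mod phi N} (bc_map_fun f)
    (GRing.isLinear.Build _ _ _ _ (bc_map_fun f) (bc_map_linear f)).

End BaseChangeHom.

(* The canonical map S (x)_R Hom_A(M, N) ->                                   *)
(*   Hom_(S (x)_R A)(S (x)_R M, S (x)_R N), s (x) f |-> s (S (x)_R f).        *)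
Definition bc_hom (R S : comPzRingType) (phi : {rmorphism R -> S})
    (A : algebra R) (M N : lmodType A) :
    bc phi (modhom M N) ->
    @modhom S (bc_alg phi A) (bc_mod phi M) (bc_mod phi N) :=
  bc_lift (fun (s : S) (f : modhom M N) => s *: bc_map phi f).

Section BaseChangeHomTheory.
Variables (R S : comPzRingType) (phi : {rmorphism R -> S}) (A : algebra R).
Variables (M N : lmodType A).

Fact bc_hom_pureE s (f : modhom M N) s' m :
  modhom_fun (s *: bc_map phi f) (pure phi s' m) =
  pure phi (s * s') (modhom_fun f m : res N).
Proof.
rewrite -[LHS]/(bc_act (bc_str phi A s) (bc_map_fun f (pure phi s' m))).
rewrite bc_map_funE bc_actE; congr (pure _ _ _); exact: (@scale1r A N).
Qed.

Fact bc_hom_balanced :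
  balanced phi (fun (s : S) (f : modhom M N) => s *: bc_map phi f).
Proof.
have ext (f g : @modhom S (bc_alg phi A) (bc_mod phi M) (bc_mod phi N)) :
    (forall t (m : res M),
       modhom_fun f (pure phi t m) = modhom_fun g (pure phi t m)) ->
    f = g.
  by move=> fg; apply: modhomP; apply: bc_eq fg;
    [exact: (raddfB (modhom_fun f)) | exact: (raddfB (modhom_fun g))].
split=> [s s' f|s f g|s r f]; apply: ext => t m.
- rewrite -[RHS]/(modhom_fun (s *: bc_map phi f) _ +
                   modhom_fun (s' *: bc_map phi f) _).
  by rewrite !bc_hom_pureE mulrDl; exact: pureDl.
- rewrite -[RHS]/(modhom_fun (s *: bc_map phi f) _ +
                   modhom_fun (s *: bc_map phi g) _).
  by rewrite !bc_hom_pureE; exact: pureDr.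
by rewrite !bc_hom_pureE mulrAC pure_bal.
Qed.

Lemma bc_homE s f s' m :
  modhom_fun (bc_hom (pure phi s f)) (pure phi s' m : bc_mod phi M) =
  pure phi (s * s') (modhom_fun f m : res N).
Proof. by rewrite /bc_hom (bc_liftE bc_hom_balanced) bc_hom_pureE. Qed.
End BaseChangeHomTheory.

Definition base_change_property (R : comPzRingType) (A : algebra R)
    (Q : lmodType A) : Prop :=
  fgproj (modhom Q Q) /\
  forall (S : comPzRingType) (phi : {rmorphism R -> S}), noetherian S ->
    bijective (@bc_hom R S phi A Q Q).

Section DominantDimension.
Variables (R : comPzRingType) (A : algebra R).

Definition in_add (T N : lmodType A) : Prop :=
  exists (n : nat) (N' : lmodType A)
    (f : {linear (N * N')%type -> {ffun 'I_n -> T}}), bijective f.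

Definition left_approx (T X N : lmodType A) (f : {linear X -> N}) : Prop :=
  in_add T N /\
  forall Y : lmodType A, in_add T Y ->
    forall g : {linear X -> Y}, exists h : {linear N -> Y}, g =1 h \o f.

Definition R_split (M N : lmodType A) (f : {linear M -> N}) : Prop :=
  exists s : {linear res N -> res M}, forall x, f (s (f x)) = f x.

Definition AR_mono (M N : lmodType A) (f : {linear M -> N}) : Prop :=
  exists s : {linear res N -> res M}, forall x, s (f x) = x.

Definition exact_at (L M N : lmodType A) (f : {linear L -> M})
    (g : {linear M -> N}) : Prop :=
  forall y, g y = 0 <-> exists x, f x = y.

(* Exactness of Hom_A(N, T) -> Hom_A(M, T) -> Hom_A(L, T) in the middle. *)
Definition hom_exact_at (T L M N : lmodType A) (f : {linear L -> M})
    (g : {linear M -> N}) : Prop :=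
  forall h : {linear M -> T},
    (forall x, h (f x) = 0) <-> exists k : {linear N -> T}, h =1 k \o g.

(* The terms of 0 -> X -> T_1 -> T_2 -> ..., with N i standing for T_(i+1). *)
Definition coaug (X : lmodType A) (N : nat -> lmodType A) (i : nat) :
    lmodType A :=
  if i is j.+1 then N j else X.

(* There is an (A,R)-exact sequence 0 -> X -> T_1 -> ... -> T_n in add T that *)
(* stays exact under Hom_A(-, T). The terms and maps beyond T_n play no role. *)
(* Each map is split over R; for the last one this says that the image is an  *)
(* R-summand of T_n, which for n = 1 makes X -> T_1 an (A,R)-monomorphism.    *)
Definition domdim_seq (T X : lmodType A) (n : nat) : Prop :=
  exists (N : nat -> lmodType A)
    (d : forall i, {linear coaug X N i -> coaug X N i.+1}),
  [/\ forall i, (i < n)%N -> in_add T (N i),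
      injective (d 0%N) /\
      (forall i, (i.+1 < n)%N -> exact_at (d i) (d i.+1)),
      forall i, (i < n)%N -> R_split (d i),
      forall h : {linear X -> T},
        exists k : {linear N 0%N -> T}, h =1 k \o d 0%N
    & forall i, (i.+1 < n)%N -> hom_exact_at T (d i) (d i.+1)].

Definition has_AR_approx (T X : lmodType A) : Prop :=
  exists (N : lmodType A) (f : {linear X -> N}), left_approx T f /\ AR_mono f.

(* Values in {0, 1, 2, ...} and +oo, seen inside the extended integers.       *)
Definition domdim (T X : lmodType A) : \bar int :=
  if `[< has_AR_approx T X >] then
    supremum 0%:E [set n%:Z%:E | n in [set n | (0 < n)%N /\ domdim_seq T X n]]
  else 0%:E.
End DominantDimension.

(* Main.v *)
Require Import Defs.
From HB Require Import structures.
From mathcomp Require Import all_boot all_order all_algebra.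
From mathcomp Require Import boolp classical_sets constructive_ereal.

Set Implicit Arguments.
Unset Strict Implicit.
Unset Printing Implicit Defensive.

Import Order.TTheory GRing.Theory.

Local Open Scope ring_scope.
Local Open Scope classical_set_scope.

(** Write [E] for the functor Hom_A(-, Q). A first step f : M -> N of a
    sequence computing the dominant dimension of M is a left
    add Q-approximation that is split over R; with C its cokernel, the
    dimension of M is at least n + 1 exactly when that of C is at least n
    ([domdim_ge], [domdim_seq_ge], [domdim_ge_seq]). This does not depend on
    the choice of f: for another choice f' : M -> N' with cokernel C', both
    C x N' and C' x N are quotients of N x N' by the same copy of M, and a
    factor in add Q does not change the dimension ([domdim_ge_coker]).

    The hypotheses on M pass to C. As E(M) is projective, the sequence
    0 -> E(C) -> E(N) -> E(M) -> 0 splits over R, so E(C) is projective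
    ([coker_dual_basis]). The sequence 0 -> M -> N -> C -> 0 splits over R as
    well, so both sequences stay exact under base change to R/m, and comparing
    them shows that the formation of E(C) commutes with this base change when
    that of E(N) and E(M) does ([bc_hom_coker]). The same splitting shows that
    f(m) is again a left approximation, with cokernel C(m)
    ([bc_left_approx], [bc_approx_seq]).

    A left approximation M -> N exists because E(M) is finitely generated
    ([generated_approx]). It is split over R if and only if all its
    reductions f(m) are ([split_local_global]): the r in R such that r times
    the identity of M factors through f form an ideal, and a retraction of
    f(m) lifts to a map t with t f = 1 modulo m, so that the adjugate of a
    matrix of t f produces an element of this ideal outside m.

    By induction on n, the dimension of M is at least n if and only if that of
    M(m) is at least n for all m ([domdim_ge_local_global]), and an element of
    {0, 1, ..., +oo} is determined by the n that it bounds
    ([threshold_inj]). *)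

(** * Linear maps, cokernels and dual bases *)

(** A linear map, bundled from its underlying function. *)
Definition lin (A : pzRingType) (U V : lmodType A) (f : U -> V)
    (lf : linear f) : {linear U -> V} :=
  HB.pack_for {linear U -> V} f (GRing.isLinear.Build A U V *:%R f lf).

Lemma lin_exists (A : pzRingType) (U V : lmodType A) (f : U -> V) :
  linear f -> exists g : {linear U -> V}, g =1 f.
Proof. by move=> lf; exists (lin lf). Qed.

Lemma linear_sumZ (A : pzRingType) (U V : lmodType A) (f : {linear U -> V})
    (I : finType) (c : I -> A) (e : I -> U) :
  f (\sum_i c i *: e i) = \sum_i c i *: f (e i).
Proof. by rewrite linear_sum; apply: eq_bigr => i _; exact: linearZ_LR. Qed.

Definition surjective (U V : Type) (f : U -> V) : Prop :=
  forall y, exists x, f x = y.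

(** A linear map that kills the kernel of a surjection p factors through p. *)
Lemma linear_factor (A : pzRingType) (N C Y : lmodType A)
    (p : {linear N -> C}) (g : {linear N -> Y}) :
  surjective p -> (forall x, p x = 0 -> g x = 0) ->
  exists h : {linear C -> Y}, forall x, h (p x) = g x.
Proof.
move=> /choice[t pt] pg.
have gE x y : p x = p y -> g x = g y.
  move=> pxy; apply/eqP; rewrite -subr_eq0 -raddfB; apply/eqP/pg.
  by rewrite raddfB /= pxy subrr.
have lh : linear (g \o t) by move=> a x y /=; rewrite -linearP; apply: gE;
  rewrite linearP !pt.
by exists (lin lh) => x /=; apply: gE; rewrite pt.
Qed.

(** A retraction s of the inclusion in 0 -> M -> N -> C -> 0 yields a
    section t of the projection, with f s + t p = 1. *)
Lemma short_exact_section (A : pzRingType) (M N C : lmodType A)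
    (f : {linear M -> N}) (p : {linear N -> C}) (s : {linear N -> M}) :
  surjective p -> (forall y, p y = 0 <-> exists x, f x = y) -> cancel f s ->
  exists t : {linear C -> N},
    cancel t p /\ forall y, f (s y) + t (p y) = y.
Proof.
move=> p_surj fp sK.
have [|t tE] := linear_factor
    (g := (idfun \- (f \o s)) : {linear N -> N}) p_surj.
  by move=> _ /fp[x <-] /=; rewrite sK subrr.
exists t; split=> [c|y]; last by rewrite tE /= addrC subrK.
have [y <-] := p_surj c; rewrite tE.
transitivity (p y - p (f (s y))); first exact: (raddfB p).
by rewrite (_ : p (f _) = 0) ?subr0 //; apply/fp; exists (s y).
Qed.

Section Cokernel.
Variables (A : pzRingType) (X N : lmodType A) (f : {linear X -> N}).

Fact im_is_subgroup : is_subgroup [set y | exists x, f x = y].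
Proof.
split=> [|_ _ [x <-] [y <-]]; first by exists 0; rewrite raddf0.
by exists (x - y); rewrite raddfB.
Qed.

Let K := Subgroup im_is_subgroup.

(** The cokernel of f, as a module: N modulo the subgroup f(X). *)
Definition coker : Type := quotg K.

HB.instance Definition _ := GRing.Zmodule.on coker.

Definition coker_pi (x : N) : coker := quotg_pi K x.

Fact coker_pi_additive : zmod_morphism coker_pi.
Proof. exact: raddfB. Qed.

HB.instance Definition _ := GRing.isZmodMorphism.Build N coker coker_pi
  coker_pi_additive.

Lemma coker_surj : surjective coker_pi.
Proof. exact: quotg_pi_surj. Qed.

Lemma coker_piP (x y : N) :
  coker_pi x = coker_pi y <-> exists z, f z = x - y.
Proof. exact: (quotg_piP K). Qed.

Definition coker_scale (a : A) (x : coker) : coker :=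
  quotg_lift (fun y => coker_pi (a *: y)) x.

Lemma coker_scaleE a x : coker_scale a (coker_pi x) = coker_pi (a *: x).
Proof.
rewrite /coker_scale /quotg_lift; apply/coker_piP.
set y := repr _; have /coker_piP[z fz] : coker_pi y = coker_pi x.
  by rewrite /coker_pi /quotg_pi reprK.
by exists (a *: z); rewrite linearZ /= fz scalerBr.
Qed.

Fact coker_scaleA a b x :
  coker_scale a (coker_scale b x) = coker_scale (a * b) x.
Proof. by have [y <-] := coker_surj x; rewrite !coker_scaleE scalerA. Qed.

Fact coker_scale1 : left_id 1 coker_scale.
Proof.
by move=> x; have [y <-] := coker_surj x; rewrite coker_scaleE scale1r.
Qed.

Fact coker_scaleDr : right_distributive coker_scale +%R.
Proof.
move=> a x y; have [x' <-] := coker_surj x; have [y' <-] := coker_surj y.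
by rewrite -raddfD !coker_scaleE scalerDr raddfD.
Qed.

Fact coker_scaleDl x : {morph coker_scale^~ x : a b / a + b}.
Proof.
move=> a b; have [y <-] := coker_surj x.
by rewrite !coker_scaleE scalerDl raddfD.
Qed.

HB.instance Definition _ := GRing.Zmodule_isLmodule.Build A coker
  coker_scaleA coker_scale1 coker_scaleDr coker_scaleDl.

Fact coker_pi_linear : linear coker_pi.
Proof.
by move=> a x y; rewrite raddfD; congr (_ + _); exact/esym/coker_scaleE.
Qed.
End Cokernel.

Lemma coker_exists (A : pzRingType) (X N : lmodType A) (f : {linear X -> N}) :
  exists (C : lmodType A) (p : {linear N -> C}),
    surjective p /\ forall y, p y = 0 <-> exists x, f x = y.
Proof.
exists (coker f), (lin (@coker_pi_linear _ _ _ f)).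
split; first exact: coker_surj.
move=> y /=; rewrite -[X in _ = X](raddf0 (coker_pi f)) coker_piP subr0.
by [].
Qed.

(** Finitely many e_i in P and linear forms l_i on P with x = sum l_i(x) e_i
    for all x. Such a family exists if and only if P is finitely generated and
    projective. *)
Definition dual_basis (R : comPzRingType) (P : lmodType R) : Prop :=
  exists (I : finType) (e : I -> P) (l : I -> {linear P -> R^o}),
    forall x, x = \sum_i l i x *: e i.

Lemma fgproj_dual_basis (R : comPzRingType) (P : lmodType R) :
  fgproj P -> dual_basis P.
Proof.
case=> [[n [g gen]] proj].
pose F : lmodType R := {ffun 'I_n -> R^o}.
have lu : linear (fun c : F => \sum_i (c i : R) *: g i).
  move=> a c d; rewrite scaler_sumr -big_split; apply: eq_bigr => i _ /=.
  by rewrite !ffunE scalerDl scalerA.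
have [|h hE] := proj F P (lin lu) (idfun : {linear P -> P}).
  by move=> y; have [c ->] := gen y; exists [ffun i => c i] => /=;
    apply: eq_bigr => i _; rewrite ffunE.
have ll i : linear (fun x => h x i : R^o).
  by move=> a x y; rewrite linearP !ffunE.
by exists 'I_n, g, (fun i => lin (ll i)) => x /=; rewrite -[LHS]hE.
Qed.

Lemma dual_basis_retract (R : comPzRingType) (P P' : lmodType R)
    (i : {linear P -> P'}) (r : {linear P' -> P}) :
  cancel i r -> dual_basis P' -> dual_basis P.
Proof.
move=> ir [I [e [l E]]].
exists I, (r \o e), (fun k => (l k \o i : {linear P -> R^o})) => x /=.
by rewrite -linear_sumZ -E ir.
Qed.

(** Having a dual basis passes from P' to the direct summands of its finite
    powers. *)
Lemma dual_basis_sum (R : comPzRingType) (J : finType) (P P' : lmodType R)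
    (i : J -> {linear P -> P'}) (r : J -> {linear P' -> P}) :
  (forall x, x = \sum_j r j (i j x)) -> dual_basis P' -> dual_basis P.
Proof.
move=> ir [I [e [l E]]].
exists (J * I)%type, (fun k => r k.1 (e k.2)),
  (fun k => (l k.2 \o i k.1 : {linear P -> R^o})) => x /=.
rewrite -(pair_bigA _ (fun j k => l k (i j x) *: r j (e k))) /= [LHS]ir.
by apply: eq_bigr => j _; rewrite -linear_sumZ -E.
Qed.

(** * The category add T *)

(** Together with [decomp_in_add]: N is in add T if and only if its identity
    is a finite sum of endomorphisms that factor through T. *)
Lemma in_add_decomp (R : comPzRingType) (A : algebra R) (T N : lmodType A) :
  in_add T N -> exists (n : nat) (a : 'I_n -> {linear N -> T})
    (b : 'I_n -> {linear T -> N}), forall x, \sum_i b i (a i x) = x.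
Proof.
case=> [n [N' [f [g fK gK]]]].
have gl : linear g by move=> c x y; apply: (can_inj fK); rewrite linearP !gK.
have al i : linear (fun x : N => f (x, 0) i).
  move=> c x y; have -> : (c *: x + y, 0 : N') = c *: (x, 0) + (y, 0).
    by congr (_, _); rewrite /= scaler0 addr0.
  by rewrite linearP !ffunE.
have bl i : linear (fun t : T => (g [ffun j => if j == i then t else 0]).1).
  move=> c x y; rewrite -[RHS]/((c *: g _ + g _).1) -gl; congr (g _).1.
  by apply/ffunP => j; rewrite !ffunE; case: eqP; rewrite ?scaler0 ?addr0.
exists n, (fun i => lin (al i)), (fun i => lin (bl i)) => x /=.
transitivity (g (\sum_i [ffun j => if j == i then f (x, 0) i else 0])).1.
  rewrite -[g]/(lin gl : _ -> _) linear_sum.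
  exact/esym/(big_morph fst (fun _ _ => erefl)).
rewrite [X in g X](_ : _ = f (x, 0)) ?fK //; apply/ffunP => j.
rewrite sum_ffunE (bigD1 j) //= ffunE eqxx big1 ?addr0 // => i ij.
by rewrite ffunE eq_sym (negPf ij).
Qed.

Lemma decomp_in_add (R : comPzRingType) (A : algebra R) (T N : lmodType A)
    (I : finType) (a : I -> {linear N -> T}) (b : I -> {linear T -> N}) :
  (forall x, \sum_i b i (a i x) = x) -> in_add T N.
Proof.
move=> ab; pose n := #|I|; pose F : lmodType A := {ffun 'I_n -> T}.
have ul : linear (fun x => [ffun i => a (enum_val i) x] : F).
  by move=> c x y; apply/ffunP => i; rewrite !ffunE linearP.
have vl : linear (fun t : F => \sum_i b (enum_val i) (t i)).
  move=> c x y; rewrite scaler_sumr -big_split; apply: eq_bigr => i _.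
  by rewrite !ffunE linearP.
have [[u uE] [v vE]] := (lin_exists ul, lin_exists vl).
have uK x : v (u x) = x.
  rewrite vE uE -[RHS]ab (reindex (@enum_val I predT)) /=;
    last exact/onW_bij/enum_val_bij.
  by apply: eq_bigr => i _; rewrite ffunE.
(* The complement of N in T^n is the cokernel of u : N -> T^n; the projector
   1 - u v factors through it. *)
have [C [p [p_surj pu]]] := coker_exists u.
have [|s sE] := linear_factor
  (g := (idfun \- (u \o v)) : {linear F -> F}) p_surj.
  by move=> _ /pu[x <-]; rewrite -[LHS]/(u x - u (v (u x))) uK subrr.
have fl : linear (fun xc : N * C => u xc.1 + s xc.2).
  by move=> c x y; rewrite /= !linearP scalerDr addrACA.
exists n, C, (lin fl); exists (fun t => (v t, p t)) => [[x c]|t] /=.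
- have pu0 z : p (u z) = 0 by apply/pu; exists z.
  have [t <-] := p_surj c; rewrite sE -[_ t]/(t - u (v t)).
  by rewrite !linearD !linearN !uK !pu0 subrr oppr0 !addr0 add0r.
- by rewrite sE /= addrC subrK.
Qed.

Lemma in_add_refl (R : comPzRingType) (A : algebra R) (T : lmodType A) :
  in_add T T.
Proof.
apply: (@decomp_in_add _ _ _ _ unit (fun=> idfun) (fun=> idfun)) => x.
by rewrite big_const card_unit /= addr0.
Qed.

Lemma in_add_prod (R : comPzRingType) (A : algebra R) (T N N' : lmodType A) :
  in_add T N -> in_add T N' -> in_add T (N * N')%type.
Proof.
move=> /in_add_decomp[n [a [b ab]]] /in_add_decomp[n' [a' [b' ab']]].
have il : linear (fun x : N => (x, 0) : N * N').
  by move=> c x y; congr (_, _); rewrite /= scaler0 addr0.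
have jl : linear (fun x : N' => (0, x) : N * N').
  by move=> c x y; congr (_, _); rewrite /= scaler0 addr0.
pose NN : lmodType A := (N * N')%type.
pose a0 (i : 'I_n + 'I_n') : {linear NN -> T} :=
  match i with inl i => a i \o fst | inr i => a' i \o snd end.
pose b0 (i : 'I_n + 'I_n') : {linear T -> NN} :=
  match i with inl i => lin il \o b i | inr i => lin jl \o b' i end.
apply: (@decomp_in_add _ _ _ NN _ a0 b0).
case=> x x'; rewrite big_sumType /=.
rewrite -(raddf_sum (lin il)) -(raddf_sum (lin jl)) /= ab ab'.
by congr (_, _); rewrite /= ?addr0 ?add0r.
Qed.

Lemma in_add_ffun (R : comPzRingType) (A : algebra R) (T : lmodType A)
    (I : finType) : in_add T {ffun I -> T}.
Proof.
have al i : linear (fun t : {ffun I -> T} => t i).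
  by move=> c x y; rewrite !ffunE.
have bl i :
    linear (fun t => [ffun j => if j == i then t else 0] : {ffun I -> T}).
  by move=> c x y; apply/ffunP => j; rewrite !ffunE; case: eqP;
    rewrite ?scaler0 ?addr0.
apply: (@decomp_in_add _ _ _ _ I (fun i => lin (al i)) (fun i => lin (bl i))).
move=> t; apply/ffunP => j; rewrite sum_ffunE (bigD1 j) //= ffunE eqxx.
by rewrite big1 ?addr0 // => i ij; rewrite ffunE eq_sym (negPf ij).
Qed.

(** It is enough to extend the maps to T itself. *)
Lemma left_approx_of_ext (R : comPzRingType) (A : algebra R)
    (T X N : lmodType A) (f : {linear X -> N}) :
  in_add T N ->
  (forall h : {linear X -> T}, exists k : {linear N -> T}, h =1 k \o f) ->
  left_approx T f.
Proof.
move=> N_add ext; split=> // Y /in_add_decomp[n [a [b ab]]] g.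
have /choice[k kE] i : exists k : {linear N -> T}, a i \o g =1 k \o f.
  exact: ext.
have hl : linear (fun x => \sum_i b i (k i x)).
  move=> c x y; rewrite scaler_sumr -big_split; apply: eq_bigr => i _.
  by rewrite !linearP.
exists (lin hl) => x /=; rewrite -[LHS]ab; apply: eq_bigr => i _.
by congr (b i _); exact: kE.
Qed.

Lemma res_linear (R : comPzRingType) (A : algebra R) (M N : lmodType A)
    (f : {linear M -> N}) : linear (f : res M -> res N).
Proof. by move=> c x y; rewrite !res_scaleE -linearP. Qed.

(** An A-linear map, seen as an R-linear map. *)
Definition res_map (R : comPzRingType) (A : algebra R) (M N : lmodType A)
    (f : {linear M -> N}) : {linear res M -> res N} := lin (res_linear f).

(** * Dominant dimension one step at a time *)

(** The sequence 0 -> X -> N -> C -> 0 is (A, R)-exact, and X -> N is a left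
    add T-approximation. *)
Definition approx_seq (R : comPzRingType) (A : algebra R) (T X N C : lmodType A)
    (f : {linear X -> N}) (p : {linear N -> C}) : Prop :=
  [/\ left_approx T f, AR_mono f, surjective p & exact_at f p].

(** The T-dominant dimension of X is at least n: there are n successive
    (A, R)-monic left add T-approximations, each starting from the cokernel of
    the one before. *)
Fixpoint domdim_ge (R : comPzRingType) (A : algebra R) (T X : lmodType A)
    (n : nat) : Prop :=
  if n is n'.+1 then
    exists (N C : lmodType A) (f : {linear X -> N}) (p : {linear N -> C}),
      approx_seq T f p /\ domdim_ge T C n'
  else True.

Section DomdimGe.
Variables (R : comPzRingType) (A : algebra R) (T : lmodType A).
Implicit Types X N C : lmodType A.

Lemma domdim_ge_anti X n m : (m <= n)%N -> domdim_ge T X n -> domdim_ge T X m.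
Proof.
elim: n m X => [|n IHn] [|m] X //= mn [N [C [f [p [fp dC]]]]].
by exists N, C, f, p; split=> //; apply: IHn dC.
Qed.

Lemma domdim_ge_prod X N n :
  in_add T N -> domdim_ge T X n -> domdim_ge T (X * N)%type n.
Proof.
case: n => // n N_add /= [N1 [C [f [p [[[N1_add ext] [s sK] p_surj fp] dC]]]]].
have gl : linear (fun xn : X * N => (f xn.1, xn.2) : N1 * N).
  by move=> c x y; congr (_, _); rewrite /= linearP.
have tl :
    linear (fun xn : res (N1 * N)%type => (s xn.1, xn.2) : res (X * N)%type).
  move=> c x y; congr (_, _).
  exact: (linearP s c x.1 y.1).
exists (N1 * N)%type, C, (lin gl), (p \o fst : {linear (N1 * N)%type -> C}).
split=> //; split.
- apply: left_approx_of_ext => [|h]; first exact: in_add_prod.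
  have h1l : linear (fun x : X => h (x, 0)).
    move=> c x y; rewrite -linearP; congr (h (_, _)).
    by rewrite /= scaler0 addr0.
  have h2l : linear (fun x : N => h (0, x)).
    move=> c x y; rewrite -linearP; congr (h (_, _)).
    by rewrite /= scaler0 addr0.
  have [k kE] := ext T (in_add_refl T) (lin h1l).
  exists ((k \o fst) \+ (lin h2l \o snd) : {linear (N1 * N)%type -> T}).
  move=> [x y] /=.
  rewrite -[k (f x)]kE /= -raddfD.
  by congr (h (_, _)); rewrite /= ?addr0 ?add0r.
- by exists (lin tl) => -[x y] /=; rewrite sK.
- by move=> c; have [x <-] := p_surj c; exists (x, 0).
- move=> [x y] /=; rewrite fp.
  split=> [[z <-]|[[z w] [<- _]]]; last by exists z.
  by exists (z, y).
Qed.

(** With T1 the target of an approximation of X x N, the projection of X x N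
    onto N extends to T1, so T1 is also the target of an approximation of X,
    with cokernel C x N. *)
Lemma domdim_ge_prodI X N n :
  in_add T N -> domdim_ge T (X * N)%type n -> domdim_ge T X n.
Proof.
case: n => // n N_add /= [N1 [C [f [p [[[N1_add ext] [s sK] p_surj fp] dC]]]]].
have il : linear (fun x : X => (x, 0) : X * N).
  by move=> c x y; congr (_, _); rewrite /= scaler0 addr0.
pose i := lin il.
have [r rE] := ext N N_add (snd : {linear (X * N)%type -> N}).
have ql : linear (fun t : N1 => (p t, r t) : C * N).
  by move=> c x y; congr (_, _); rewrite /= linearP.
exists N1, (C * N)%type, (f \o i : {linear X -> N1}), (lin ql).
split; last exact: domdim_ge_prod.
split.
- apply: left_approx_of_ext => // h.
  have [k kE] := ext T (in_add_refl T) (h \o fst : {linear (X * N)%type -> T}).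
  by exists k => x /=; rewrite -[RHS]kE.
- have tl : linear (fun x : res N1 => (s x).1 : res X).
    by move=> c x y; rewrite linearP.
  by exists (lin tl) => x /=; rewrite sK.
- move=> [c y]; have [t pt] := p_surj c; exists (t + f (0, y - r t)).
  congr (_, _); rewrite raddfD /= -?[r (f _)]rE /= ?pt;
    last by rewrite addrC subrK.
  have -> : p (f (0, y - r t)) = 0 by apply/fp; exists (0, y - r t).
  by rewrite addr0.
- move=> t; split=> [[/fp[[x y] <-]]|[x <-]] /=.
    by rewrite -[r _]rE /= => ->; exists x.
  congr (_, _); first by apply/fp; exists (x, 0).
  by rewrite -[LHS]rE.
Qed.

(** Two quotients of P by the same kernel are isomorphic, hence have the same
    dominant dimension. *)
Lemma domdim_ge_quotient (P X X' : lmodType A) (p : {linear P -> X})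
    (p' : {linear P -> X'}) n :
  surjective p -> surjective p' -> (forall x, p x = 0 <-> p' x = 0) ->
  domdim_ge T X n -> domdim_ge T X' n.
Proof.
case: n => // n p_surj p'_surj pp' /=.
move=> [N [C [f [q [[[N_add ext] [s sK] q_surj fq] dC]]]]].
have [|u uE] := linear_factor (g := p') p_surj; first by move=> x /pp'.
have [|v vE] := linear_factor (g := p) p'_surj; first by move=> x /pp'.
have vK : cancel v u by move=> x; have [y <-] := p'_surj x; rewrite vE uE.
have uK : cancel u v by move=> x; have [y <-] := p_surj x; rewrite uE vE.
exists N, C, (f \o v : {linear X' -> N}), q; split=> //; split=> //.
- apply: left_approx_of_ext => // h.
  have [k kE] := ext T (in_add_refl T) (h \o u : {linear X -> T}).
  by exists k => x /=; rewrite -[RHS]kE /= vK.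
- by exists (res_map u \o s : {linear res N -> res X'}) => x /=; rewrite sK vK.
- move=> y; rewrite fq; split=> [[x <-]|[x <-]]; last by exists (v x).
  by exists (u x); rewrite /= uK.
Qed.

(** The choice of the approximation does not matter: any cokernel of an
    (A, R)-monic left approximation can be used for the next step. *)
Lemma domdim_ge_coker X N C (f : {linear X -> N}) (p : {linear N -> C}) n :
  approx_seq T f p -> domdim_ge T X n.+1 -> domdim_ge T C n.
Proof.
move=> [[N_add ext] _ p_surj fp].
move=> /= [N' [C' [f' [p' [[[N'_add ext'] _ p'_surj fp'] dC']]]]].
(* Both maps below have kernel {(f x, - f' x)}, by h f = f' and h' f' = f. *)
have [h hE] := ext N' N'_add f'; have [h' h'E] := ext' N N_add f.
have ul : linear (fun ab : N * N' => (p ab.1, ab.2 + h ab.1) : C * N').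
  move=> c x y; congr (_, _); rewrite /= !linearP //.
  by rewrite scalerDr addrACA.
have vl : linear (fun ab : N * N' => (p' ab.2, ab.1 + h' ab.2) : C' * N).
  move=> c x y; congr (_, _); rewrite /= !linearP //.
  by rewrite scalerDr addrACA.
apply: (@domdim_ge_prodI _ N') => //.
apply: (@domdim_ge_quotient _ _ _ (lin vl) (lin ul));
  last exact: domdim_ge_prod dC'.
- move=> [c y]; have [b <-] := p'_surj c; exists (y - h' b, b).
  by rewrite /= subrK.
- move=> [c y]; have [a <-] := p_surj c; exists (a, y - h a).
  by rewrite /= subrK.
- move=> [a b] /=; split=> -[] => [/fp'[x <-]|/fp[x <-]].
  + rewrite -[h' _]h'E => /eqP; rewrite addr_eq0 => /eqP ->.
    congr (_, _); first by apply/fp; exists (- x); rewrite raddfN.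
    by rewrite raddfN /= -[h _]hE subrr.
  + rewrite -[h _]hE => /eqP; rewrite addr_eq0 => /eqP ->.
    congr (_, _); first by apply/fp'; exists (- x); rewrite raddfN.
    by rewrite raddfN /= -[h' _]h'E subrr.
Qed.

(** If X has one (A, R)-monic left approximation, all of them are. *)
Lemma approx_AR_mono X N (f : {linear X -> N}) n :
  left_approx T f -> domdim_ge T X n.+1 -> AR_mono f.
Proof.
move=> [N_add ext] [N' [C' [f' [p' [[[N'_add _] [s sK] _ _] _]]]]].
have [h hE] := ext N' N'_add f'.
exists (s \o res_map h : {linear res N -> res X}) => x /=.
by rewrite -[h _]hE sK.
Qed.
End DomdimGe.

Section DomdimSeq.
Variables (R : comPzRingType) (A : algebra R) (T : lmodType A).
Implicit Types X N C : lmodType A.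

Lemma has_AR_approx_ge1 X : has_AR_approx T X <-> domdim_ge T X 1.
Proof.
split=> [[N [f [fT fm]]]|[N [_ [f [_ [[fT fm _ _] _]]]]]]; last by exists N, f.
by have [C [p [p_surj fp]]] := coker_exists f; exists N, C, f, p.
Qed.

Lemma domdim_seq_ge X n : domdim_seq T X n.+1 -> domdim_ge T X n.+1.
Proof.
elim: n X => [|n IHn] X [N [d [N_add [d_inj d_ex] d_split d_ext d_hex]]].
  apply/has_AR_approx_ge1; exists (N 0%N), (d 0%N); split.
    by apply: left_approx_of_ext => //; exact: N_add.
  by have [s sE] := d_split 0%N isT; exists s => x; apply: d_inj.
(* The maps d 1, d 2, ... form a sequence for the cokernel of d 0, once d 1 is
   factored through it. *)
have [C [p [p_surj dp]]] := coker_exists (d 0%N).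
have d10 := d_ex 0%N isT.
have [|e eE] := linear_factor (g := d 1%N) p_surj.
  by move=> x /dp; rewrite d10.
exists (N 0%N), C, (d 0%N), p; split.
  split=> //; first by apply: left_approx_of_ext => //; exact: N_add.
  by have [s sE] := d_split 0%N isT; exists s => x; apply: d_inj.
apply: IHn; exists (fun i => N i.+1).
exists (fun i => match i return {linear coaug C (fun i => N i.+1) i ->
                                 coaug C (fun i => N i.+1) i.+1} with
                 | 0 => e | i.+1 => d i.+2 end).
split=> [i|||h|].
- exact: (N_add i.+1).
- split=> [x y /= exy|[|i] iN].
  + have [x' xE] := p_surj x; have [y' yE] := p_surj y.
    move: exy; rewrite -xE -yE !eE => /eqP; rewrite -subr_eq0 -raddfB => /eqP.
    by move/d10/dp/eqP; rewrite raddfB subr_eq0 => /eqP.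
  + move=> y; rewrite (d_ex 1%N iN); split=> [[x <-]|[x <-]].
      by exists (p x); rewrite eE.
    by have [x' <-] := p_surj x; exists x'; rewrite eE.
  + exact: (d_ex i.+2).
- case=> [|i] iN; last exact: (d_split i.+2).
  have [s sE] := d_split 1%N iN.
  exists (res_map p \o s : {linear res (N 1%N) -> res C}) => x.
  by have [x' <-] := p_surj x; rewrite /= !eE sE.
- have [x /=|k kE] := (d_hex 0%N isT (h \o p)).1.
    by rewrite (_ : p _ = 0) ?raddf0 //; apply/dp; exists x.
  exists k => x; have [x' <-] := p_surj x.
  by rewrite /= eE -[RHS]kE.
- case=> [|i] iN; last exact: (d_hex i.+2).
  move=> h; rewrite -(d_hex 1%N iN h); split=> hd x; last first.
    by have [x' <-] := p_surj x; rewrite eE.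
  by rewrite -eE.
Qed.

Lemma domdim_ge_seq X n : domdim_ge T X n.+1 -> domdim_seq T X n.+1.
Proof.
elim: n X => [|n IHn] X [N [C [f [p [[[N_add ext] [s sK] p_surj fp] dC]]]]].
  exists (fun=> N), (fun i => match i return
    {linear coaug X (fun=> N) i -> N} with 0 => f | _ => \0 end).
  split=> //.
  - split=> // x y fxy; have := congr1 s fxy; by rewrite !sK.
  - by case=> // _; exists s => x /=; rewrite sK.
  - by move=> h; apply: ext; exact: in_add_refl.
have {IHn dC} [M [d [M_add [d_inj d_ex] d_split d_ext d_hex]]] := IHn C dC.
have f_inj : injective f by move=> x y fxy; have := congr1 s fxy; rewrite !sK.
have d0p x : d 0%N (p x) = 0 <-> p x = 0.
  split=> [dx|->]; last by rewrite raddf0.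
  by apply: d_inj; rewrite dx raddf0.
(* The sequence for C, prepended with f; its first map becomes d 0 after p. *)
pose M' i := if i is j.+1 then M j else N.
exists M', (fun i => match i return
    {linear coaug X M' i -> coaug X M' i.+1} with
  | 0 => f | 1 => d 0%N \o p | i.+2 => d i.+1 end).
split.
- by case=> [_|i]; [exact: N_add | exact: M_add].
- split=> // -[|[|i]] iN.
  + by move=> y /=; rewrite d0p fp.
  + move=> y; rewrite (d_ex 0%N iN); split=> [[x <-]|[x <-]] /=.
      by have [x' <-] := p_surj x; exists x'.
    by exists (p x).
  + exact: (d_ex i.+1).
- case=> [|[|i]] iN; last exact: (d_split i.+1).
  + by exists s => x; rewrite sK.
  + have [u uE] := d_split 0%N iN.
    have [t [pt _]] := short_exact_section (f := res_map f)
      (p := res_map p) p_surj fp sK.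
    exists (t \o u : {linear res (M 0%N) -> res N}) => x /=.
    by rewrite [p _]pt uE.
- by move=> h; apply: ext; exact: in_add_refl.
- case=> [|[|i]] iN; last exact: (d_hex i.+1).
  + move=> h; split=> [hf|[k kE] x]; last first.
      by rewrite kE /= (_ : p _ = 0) ?raddf0 //; apply/fp; exists x.
    have [|h' h'E] := linear_factor (g := h) p_surj.
      by move=> _ /fp[x <-]; exact: hf.
    by have [k kE] := d_ext h'; exists k => x; rewrite -h'E kE.
  + move=> h; rewrite -(d_hex 0%N iN h); split=> hd x; last exact: hd.
    by have [x' <-] := p_surj x; exact: hd.
Qed.

End DomdimSeq.

(** * Elements of {0, 1, ..., +oo} as thresholds *)

(** For a downward closed P: v is the largest element of {0, 1, ..., +oo} such
    that P n holds for all natural n <= v. It is unique ([threshold_inj]). *)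
Definition is_threshold (P : nat -> Prop) (v : \bar int) : Prop :=
  (v = +oo%E /\ forall n, P n) \/
  (exists n, [/\ v = n%:Z%:E, P n & ~ P n.+1]).

Definition down_closed (P : nat -> Prop) : Prop :=
  P 0%N /\ forall m n, (m <= n)%N -> P n -> P m.

Lemma threshold_inj (P : nat -> Prop) v w :
  down_closed P -> is_threshold P v -> is_threshold P w -> v = w.
Proof.
move=> [_ Pd] [[-> Pv]|[n [-> Pn nPn]]] [[-> Pw]|[m [-> Pm nPm]]] //.
by case: (ltngtP n m) => [nm|mn|-> //]; [case: nPn | case: nPm];
  [apply: (Pd _ m) | apply: (Pd _ n)].
Qed.

Lemma down_closed_cases (P : nat -> Prop) :
  P 0%N -> (forall n, P n) \/ exists n, P n /\ ~ P n.+1.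
Proof.
move=> P0; case: (pselect (forall n, P n)) => [|nP]; [by left|right].
have /existsNP[n] := nP; elim: n => // n IHn nPn.
by case: (pselect (P n)) => [Pn|/IHn //]; exists n.
Qed.

Lemma le_threshold (P : nat -> Prop) v n : down_closed P -> is_threshold P v ->
  (n%:Z%:E <= v)%E <-> P n.
Proof.
move=> [_ Pd] [[-> Pv]|[m [-> Pm nPm]]]; first by split=> // _; rewrite leey.
rewrite lee_fin lez_nat; split=> [nm|Pn]; first exact: Pd Pm.
by rewrite leqNgt; apply/negP => mn; apply: nPm; apply: Pd Pn.
Qed.

(** v is below w as soon as all natural numbers satisfying P are. *)
Lemma threshold_le (P : nat -> Prop) v (w : \bar int) : is_threshold P v ->
  (forall n, P n -> (n%:Z%:E <= w)%E) -> (v <= w)%E.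
Proof.
move=> [[-> Pv]|[m [-> Pm nPm]]] Pw; last exact: Pw.
case: w Pw => [z|//|] Pw; last by have := Pw 0%N (Pv _).
have := Pw `|z|.+1%N (Pv _); rewrite lee_fin => h; exfalso.
by have := Order.POrderTheory.le_trans h (lez_abs z); rewrite lez_nat ltnn.
Qed.

Lemma supremumE (x0 v : \bar int) (S : set (\bar int)) :
  S !=set0 -> supremums S v -> supremum x0 S = v.
Proof.
move=> /set0P/negPf S0 Sv; rewrite /supremum S0.
case: xgetP => [w -> [Sw1 Sw2]|/(_ v) //].
by case: Sv => Sv1 Sv2; apply/eqP; rewrite eq_le Sv2 // Sw2.
Qed.

Lemma infimumE (x0 v : \bar int) (S : set (\bar int)) :
  S !=set0 -> infimums S v -> infimum x0 S = v.
Proof.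
move=> /set0P/negPf S0 Sv; rewrite /infimum S0.
case: xgetP => [w -> [Sw1 Sw2]|/(_ v) //].
by case: Sv => Sv1 Sv2; apply/eqP; rewrite eq_le Sv2 // Sw2.
Qed.

Lemma domdim_ge_down_closed (R : comPzRingType) (A : algebra R)
    (T X : lmodType A) :
  down_closed (domdim_ge T X).
Proof. by split=> // m n mn; exact: domdim_ge_anti. Qed.

Lemma domdim_threshold (R : comPzRingType) (A : algebra R) (T X : lmodType A) :
  is_threshold (domdim_ge T X) (domdim T X).
Proof.
rewrite /domdim; case: asboolP => [/has_AR_approx_ge1 d1|nd]; last first.
  by right; exists 0%N; split=> // /has_AR_approx_ge1.
set S := [set _ | n in _].
have S_ge n : (0 < n)%N -> S n%:Z%:E <-> domdim_ge T X n.
  move=> n0; split=> [[[|m] [//= _ mE]]|dn].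
    by move=> [] <-; exact: domdim_seq_ge.
  by exists n => //; split=> //; case: n n0 dn => // n _; exact: domdim_ge_seq.
have S0 : S !=set0 by exists 1%E; apply/S_ge.
have [dP|[n [dn ndn]]] := down_closed_cases (domdim_ge_down_closed T X).1.
  left; split=> //; apply: supremumE => //.
  split=> [w _|w Sw]; first exact: leey.
  apply: (@threshold_le (domdim_ge T X)); first by left.
  move=> n _; apply: (@Order.POrderTheory.le_trans _ _ n.+1%:Z%:E).
    by rewrite lee_fin lez_nat.
  by apply: Sw; apply/S_ge.
right; exists n; split=> //; apply: supremumE => //.
have n0 : (0 < n)%N by rewrite lt0n; apply/eqP => n0; apply: ndn; rewrite n0.
split=> [_ [m [m0 dm] <-]|w Sw]; last by apply: Sw; apply/S_ge.
rewrite lee_fin lez_nat leqNgt; apply/negP => nm; apply: ndn.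
apply: (domdim_ge_anti nm); case: m m0 dm {nm} => // m _.
exact: domdim_seq_ge.
Qed.

(** The infimum of thresholds is the threshold of the conjunction; for an empty
    family both are +oo. *)
Lemma infimum_threshold (I : Type) (D : set I) (P : I -> nat -> Prop)
    (v : I -> \bar int) :
  (forall i, D i -> down_closed (P i) /\ is_threshold (P i) (v i)) ->
  is_threshold (fun n => forall i, D i -> P i n)
    (infimum +oo%E [set v i | i in D]).
Proof.
move=> DP; set S := [set _ | _ in _].
case: (pselect (S !=set0)) => [S0|nS0]; last first.
  have S0 : S = set0 by apply/eqP/negP => /negP/set0P.
  left; rewrite /infimum S0 eqxx; split=> // n i Di.
  by case: nS0; exists (v i), i.
have D0 i (Di : D i) : P i 0%N := (DP i Di).1.1.
have [dP|[n [dn ndn]]] :=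
  @down_closed_cases (fun n => forall i, D i -> P i n) D0.
  left; split=> //; apply: infimumE => //.
  split=> [_ [i Di <-]|w _]; last exact: leey.
  have [Pd Pv] := DP i Di.
  case: Pv => [[-> //]|[m [_ _ []]]]; exact: dP.
right; exists n; split=> //; apply: infimumE => //; split=> [_ [i Di <-]|w Sw].
  have [Pd Pv] := DP i Di; apply/(le_threshold _ Pd Pv); exact: dn.
move/existsNP: ndn => [i /not_implyP[Di ndn]]; have [Pd Pv] := DP i Di.
suff <- : v i = n%:Z%:E by apply: Sw; exists i.
by apply: (threshold_inj Pd Pv); right; exists n; split=> //; exact: dn.
Qed.

(** * Base change of linear maps *)

Lemma inj_surj_bij (U V : Type) (f : U -> V) :
  injective f -> surjective f -> bijective f.
Proof.
by move=> f_inj /choice[g fg]; exists g => // x; apply: f_inj; rewrite fg.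
Qed.

Lemma bij_surj (U V : Type) (f : U -> V) : bijective f -> surjective f.
Proof. by case=> g _ fg y; exists (g y). Qed.

Lemma linear_lift (A : pzRingType) (U P P' : lmodType A)
    (i : {linear P -> P'}) (g : {linear U -> P'}) :
  injective i -> (forall u, exists x, i x = g u) ->
  exists r : {linear U -> P}, forall u, i (r u) = g u.
Proof.
move=> i_inj /choice[r rE].
have rl : linear r by move=> c x y; apply: i_inj; rewrite linearP !rE linearP.
by exists (lin rl).
Qed.

Section BaseChangeMap.
Variables (R S : comPzRingType) (phi : {rmorphism R -> S}).
Implicit Types U V W : lmodType R.

(** The map S (x)_R f : S (x)_R U -> S (x)_R V, s (x) u |-> s (x) f u. *)
Definition bc_lmap_fun U V (f : {linear U -> V}) : bc phi U -> bc phi V :=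
  bc_lift (fun (s : S) (u : U) => pure phi s (f u)).

Fact bc_lmap_balanced U V (f : {linear U -> V}) :
  balanced phi (fun (s : S) (u : U) => pure phi s (f u)).
Proof.
split=> *; rewrite ?pureDl //; first by rewrite raddfD pureDr.
by rewrite pure_bal linearZ_LR.
Qed.

Fact bc_lmap_linear U V (f : {linear U -> V}) : linear (bc_lmap_fun f).
Proof.
have fB : zmod_morphism (bc_lmap_fun f).
  exact: bc_lift_additive (bc_lmap_balanced f).
move=> s x y; rewrite [LHS](zmorphD fB); congr (_ + _).
elim/bc_ind: x => [|x x' IH IH'|t u].
  by rewrite scaler0 (zmorph0 fB) scaler0.
  by rewrite scalerDr !(zmorphD fB) scalerDr IH IH'.
have fE c v : bc_lmap_fun f (pure phi c v) = pure phi c (f v).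
  exact: bc_liftE (bc_lmap_balanced f) _ _.
by rewrite bc_scale_pure !fE bc_scale_pure.
Qed.

Definition bc_lmap U V (f : {linear U -> V}) : {linear bc phi U -> bc phi V} :=
  lin (bc_lmap_linear f).

Lemma bc_lmapE U V (f : {linear U -> V}) s u :
  bc_lmap f (pure phi s u) = pure phi s (f u).
Proof. exact: bc_liftE (bc_lmap_balanced f) _ _. Qed.

Lemma pure0 U s : pure phi s (0 : U) = 0.
Proof.
by rewrite -(addrK (pure phi s 0) (pure phi s 0)) -pureDr addr0 subrr.
Qed.

Lemma pure_sum U (I : Type) (r : seq I) (P : pred I) s (F : I -> U) :
  pure phi s (\sum_(i <- r | P i) F i) = \sum_(i <- r | P i) pure phi s (F i).
Proof.
by apply: (big_morph (pure phi s : U -> _)); [exact: pureDr | exact: pure0].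
Qed.

Lemma bc_lmap_sum_id U V (I : finType) (f : I -> {linear U -> V})
    (g : I -> {linear V -> U}) :
  (forall u, \sum_i g i (f i u) = u) ->
  forall x, \sum_i bc_lmap (g i) (bc_lmap (f i) x) = x.
Proof.
move=> fg; elim/bc_ind=> [|x y IHx IHy|s u].
- by rewrite big1 // => i _; rewrite !raddf0.
- rewrite -[in RHS]IHx -[in RHS]IHy -big_split; apply: eq_bigr => i _.
  by rewrite !linearD.
rewrite -[in RHS](fg u) pure_sum; apply: eq_bigr => i _.
by rewrite !bc_lmapE.
Qed.

Lemma bc_lmapK U V (f : {linear U -> V}) (g : {linear V -> U}) :
  cancel f g -> cancel (bc_lmap f) (bc_lmap g).
Proof.
move=> fg x; rewrite -[RHS](@bc_lmap_sum_id _ _ unit (fun=> f) (fun=> g)).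
  by rewrite big_const card_unit /= addr0.
by move=> u; rewrite big_const card_unit /= addr0 fg.
Qed.

Lemma bc_lmap_split U V W (f : {linear U -> V}) (p : {linear V -> W})
    (s : {linear V -> U}) (t : {linear W -> V}) :
  (forall v, f (s v) + t (p v) = v) ->
  forall x, bc_lmap f (bc_lmap s x) + bc_lmap t (bc_lmap p x) = x.
Proof.
move=> fstp; elim/bc_ind=> [|x y IHx IHy|c v].
- by rewrite !raddf0 addr0.
- by rewrite -[in RHS]IHx -[in RHS]IHy !linearD addrACA.
by rewrite !bc_lmapE -pureDr fstp.
Qed.

Lemma bc_lmap_comp0 U V W (f : {linear U -> V}) (p : {linear V -> W}) :
  (forall u, p (f u) = 0) -> forall x, bc_lmap p (bc_lmap f x) = 0.
Proof.
move=> pf; elim/bc_ind=> [|x y IHx IHy|c v]; first by rewrite !raddf0.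
  by rewrite !linearD IHx IHy addr0.
by rewrite !bc_lmapE pf pure0.
Qed.

End BaseChangeMap.

Arguments bc_lmap_sum_id {R S} phi {U V I f g}.
Arguments bc_lmapK {R S} phi {U V f g}.
Arguments bc_lmap_split {R S} phi {U V W f p s t}.
Arguments bc_lmap_comp0 {R S} phi {U V W f p}.

(** * The functor Hom_A(-, Q) *)

Section Precomp.
Variables (R : comPzRingType) (A : algebra R) (Q : lmodType A).

(** Hom_A(f, Q), that is h |-> h f. *)
Definition precomp_fun (M N : lmodType A) (f : {linear M -> N})
    (h : modhom N Q) : modhom M Q := modhom_fun h \o f.

Fact precomp_linear (M N : lmodType A) (f : {linear M -> N}) :
  linear (precomp_fun f).
Proof. by move=> r h k; apply: modhomP. Qed.

Definition precomp (M N : lmodType A) (f : {linear M -> N}) :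
  {linear modhom N Q -> modhom M Q} := lin (precomp_linear f).

Lemma modhom_sumE (M N : lmodType A) (I : Type) (r : seq I) (P : pred I)
    (F : I -> modhom M N) x :
  modhom_fun (\sum_(i <- r | P i) F i) x =
  \sum_(i <- r | P i) modhom_fun (F i) x.
Proof. exact: (big_morph (fun h : modhom M N => modhom_fun h x)). Qed.

Lemma precomp_sum_id (N : lmodType A) (I : finType) (a : I -> {linear N -> Q})
    (b : I -> {linear Q -> N}) :
  (forall x, \sum_i b i (a i x) = x) ->
  forall h : modhom N Q, \sum_i precomp (a i) (precomp (b i) h) = h.
Proof.
move=> ab h; apply: modhomP => x; rewrite modhom_sumE -[in RHS](ab x).
by rewrite linear_sum.
Qed.

Lemma add_dual_basis (N : lmodType A) : in_add Q N ->
  dual_basis (res Q) -> dual_basis (modhom Q Q) ->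
  dual_basis (res N) /\ dual_basis (modhom N Q).
Proof.
move=> /in_add_decomp[n [a [b ab]]] dQ dQQ; split.
  apply: (dual_basis_sum (i := fun i => res_map (a i))
    (r := fun i => res_map (b i)) _ dQ) => x.
  exact/esym/ab.
apply: (dual_basis_sum (i := fun i => precomp (b i))
  (r := fun i => precomp (a i)) _ dQQ) => h.
exact/esym/precomp_sum_id.
Qed.

(** When every map M -> Q extends along f and Hom_A(M, Q) has a dual basis,
    the surjection Hom_A(N, Q) -> Hom_A(M, Q) is split over R: it suffices to
    extend the basis elements. *)
Lemma precomp_section (M N : lmodType A) (f : {linear M -> N}) :
  (forall h : {linear M -> Q}, exists k : {linear N -> Q}, h =1 k \o f) ->
  dual_basis (modhom M Q) ->
  exists s : {linear modhom M Q -> modhom N Q}, cancel s (precomp f).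
Proof.
move=> ext [I [e [l lE]]].
have /choice[k kE] i : exists k : modhom N Q, precomp f k = e i.
  have [k kE] := ext (modhom_fun (e i)).
  by exists k; apply: modhomP => x; rewrite kE.
have sl : linear (fun h => \sum_i (l i h : R) *: k i).
  move=> c x y; rewrite scaler_sumr -big_split; apply: eq_bigr => i _ /=.
  by rewrite linearP scalerDl scalerA.
exists (lin sl) => h; rewrite [LHS](linear_sumZ (precomp f)) [RHS]lE.
by apply: eq_bigr => i _; rewrite kE.
Qed.

(** The splitting of 0 -> Hom_A(C, Q) -> Hom_A(N, Q) -> Hom_A(M, Q) -> 0 given
    by a section of the last map. *)
Lemma precomp_retraction (M N C : lmodType A) (f : {linear M -> N})
    (p : {linear N -> C}) (s : {linear modhom M Q -> modhom N Q}) :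
  surjective p -> exact_at f p -> cancel s (precomp f) ->
  exists r : {linear modhom N Q -> modhom C Q},
    cancel (precomp p) r /\
    forall h, precomp p (r h) + s (precomp f h) = h.
Proof.
move=> p_surj fp sK.
have pI : injective (precomp p).
  move=> h k hk; apply: modhomP => y; have [x <-] := p_surj y.
  exact: (congr1 (fun u => modhom_fun u x) hk).
have [|r rE] := linear_lift (i := precomp p)
    (g := idfun \- (s \o precomp f) : {linear modhom N Q -> modhom N Q}) pI.
  move=> h /=; set g := h - _.
  have gf x : modhom_fun g (f x) = 0.
    rewrite -[LHS]/(modhom_fun (precomp f g) x) /g linearB sK subrr.
    by [].
  have [|k kE] := linear_factor (g := modhom_fun g) p_surj.
    by move=> _ /fp[x <-]; exact: gf.
  by exists k; apply: modhomP => x; exact: kE.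
have rE' h : precomp p (r h) + s (precomp f h) = h by rewrite rE /= subrK.
exists r; split=> // k; apply: pI; rewrite -[RHS]rE'.
have -> : precomp f (precomp p k) = 0; last by rewrite raddf0 addr0.
apply: modhomP => x /=; rewrite (_ : p (f x) = 0) ?raddf0 //.
by apply/fp; exists x.
Qed.

Lemma coker_dual_basis (M N C : lmodType A) (f : {linear M -> N})
    (p : {linear N -> C}) :
  approx_seq Q f p -> dual_basis (res N) -> dual_basis (modhom N Q) ->
  dual_basis (modhom M Q) -> dual_basis (res C) /\ dual_basis (modhom C Q).
Proof.
move=> [[N_add ext] [s sK] p_surj fp] dN dNQ dMQ; split.
  have [t [pt _]] := short_exact_section (f := res_map f)
    (p := res_map p) p_surj fp sK.
  exact: dual_basis_retract pt dN.
have [u uK] := precomp_section (ext Q (in_add_refl Q)) dMQ.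
have [r [rK _]] := precomp_retraction p_surj fp uK.
exact: dual_basis_retract rK dNQ.
Qed.

End Precomp.

(** * Base change of approximations *)

Section BaseChangeApprox.
Variables (R S : comPzRingType) (phi : {rmorphism R -> S}) (A : algebra R).
Variable Q : lmodType A.
Implicit Types M N C : lmodType A.
Local Notation bcf f := (@bc_map_fun R S phi A _ _ f).
Local Notation bch M := (@bc_hom R S phi A M Q).

Lemma bc_homB M : zmod_morphism (bch M).
Proof. exact/bc_lift_additive/bc_hom_balanced. Qed.

Lemma bc_str_scale M (s : S) (x : bc phi (res M)) :
  bc_act (bc_str phi A s) x = s *: x.
Proof.
elim/bc_ind: x => [|x y IHx IHy|t m].
- by rewrite (zmorph0 (bc_actBr _)) scaler0.
- by rewrite (zmorphD (bc_actBr _)) scalerDr IHx IHy.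
rewrite bc_actE bc_scale_pure; congr (pure _ _ _); exact: (@scale1r A M).
Qed.

(** Naturality in M of S (x) Hom_A(M, Q) -> Hom(S (x) M, S (x) Q). *)
Lemma bc_hom_precomp M N (f : {linear M -> N}) x y :
  modhom_fun (bch M (bc_lmap phi (precomp Q f) x)) y =
  modhom_fun (bch N x) (bcf f y).
Proof.
elim/bc_ind: x => [|x x' IHx IHx'|s h].
- by rewrite raddf0 !(zmorph0 (@bc_homB _)).
- rewrite linearD !(zmorphD (@bc_homB _)).
  by congr (_ + _).
elim/bc_ind: y => [|y y' IHy IHy'|t m].
- by rewrite (zmorph0 (bc_map_funB f)) !raddf0.
- rewrite (zmorphD (bc_map_funB f)) [LHS]raddfD [RHS]raddfD.
  by congr (_ + _); [exact: IHy | exact: IHy'].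
by rewrite bc_lmapE bc_homE bc_map_funE bc_homE.
Qed.

Lemma bc_in_add N : in_add Q N ->
  @in_add S (bc_alg phi A) (bc_mod phi Q) (bc_mod phi N).
Proof.
move=> /in_add_decomp[n [a [b ab]]].
apply: (@decomp_in_add _ _ _ _ 'I_n (fun i => bc_map phi (a i))
  (fun i => bc_map phi (b i))) => x.
exact: (bc_lmap_sum_id phi (f := fun i => res_map (a i))
  (g := fun i => res_map (b i)) ab x).
Qed.

Lemma bc_hom_add N : in_add Q N -> bijective (bch Q) -> bijective (bch N).
Proof.
move=> /in_add_decomp[n [a [b ab]]] Q_bij.
have bca := bc_lmap_sum_id phi (f := fun i => res_map (a i))
  (g := fun i => res_map (b i)) ab.
have bch_id := bc_lmap_sum_id phi (precomp_sum_id ab).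
apply: inj_surj_bij => [x y xy|h].
  apply/eqP; rewrite -subr_eq0; apply/eqP; rewrite -[LHS]bch_id.
  rewrite big1 // => i _.
  rewrite (_ : bc_lmap phi (precomp Q (b i)) _ = 0) ?raddf0 //.
  apply: (bij_inj Q_bij); rewrite (zmorph0 (@bc_homB _)); apply: modhomP => z.
  by rewrite bc_hom_precomp bc_homB xy subrr.
have /choice[x xE] i : exists x, bch Q x = modhom_fun h \o bc_map phi (b i).
  exact: bij_surj.
exists (\sum_i bc_lmap phi (precomp Q (a i)) (x i)); apply: modhomP => y.
rewrite (big_morph _ (zmorphD (@bc_homB N)) (zmorph0 (@bc_homB N))).
rewrite modhom_sumE -[in RHS](bca y) linear_sum; apply: eq_bigr => i _.
by rewrite bc_hom_precomp xE.
Qed.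

(** Every map h : S (x) M -> S (x) Q comes from S (x) Hom_A(M, Q), and elements
    of the latter lift to S (x) Hom_A(N, Q), whose images extend h. *)
Lemma bc_left_approx M N (f : {linear M -> N}) :
  left_approx Q f -> dual_basis (modhom M Q) -> bijective (bch M) ->
  @left_approx S (bc_alg phi A) (bc_mod phi Q) (bc_mod phi M) (bc_mod phi N)
    (bc_map phi f).
Proof.
move=> [N_add ext] MQ_dual M_bij.
have [u uK] := precomp_section (ext Q (in_add_refl Q)) MQ_dual.
apply: left_approx_of_ext => [|h]; first exact: bc_in_add.
have [x xE] := bij_surj M_bij h.
exists (bch N (bc_lmap phi u x)) => y; rewrite -[h]xE.
rewrite -[X in bch M X](bc_lmapK phi uK).
exact: bc_hom_precomp.
Qed.

Section Split.
Variables (M N C : lmodType A) (f : {linear M -> N}) (p : {linear N -> C}).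
Hypothesis fp : approx_seq Q f p.
Hypothesis MQ_dual : dual_basis (modhom M Q).
Hypothesis M_bij : bijective (bch M).

Lemma bc_approx_seq :
  @approx_seq S (bc_alg phi A) (bc_mod phi Q) (bc_mod phi M) (bc_mod phi N)
    (bc_mod phi C) (bc_map phi f) (bc_map phi p).
Proof.
have [[N_add ext] [s sK] p_surj fp_ex] := fp.
have [t [pt fstp]] := short_exact_section (f := res_map f)
  (p := res_map p) p_surj fp_ex sK.
have pf x : p (f x) = 0 by apply/fp_ex; exists x.
split.
- by apply: bc_left_approx => //; split.
- have sl : linear (bc_lmap phi s : @res S (bc_alg phi A) (bc_mod phi N) ->
                                    @res S (bc_alg phi A) (bc_mod phi M)).
    move=> c x y; rewrite !res_scaleE.
    by rewrite -![_ *: _]/(bc_act (bc_str phi A c) _) !bc_str_scale linearP.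
  exists (lin sl) => x.
  exact: (bc_lmapK phi (f := res_map f) (g := s) sK).
- move=> c; exists (bc_lmap phi t c).
  exact: (bc_lmapK phi (f := t) (g := res_map p) pt).
- move=> y; split=> [py|[x <-]].
    exists (bc_lmap phi s y).
    rewrite -[RHS](bc_lmap_split phi fstp).
    by rewrite (_ : bc_lmap phi (res_map p) y = 0) ?raddf0 ?addr0.
  exact: (bc_lmap_comp0 phi (f := res_map f) (p := res_map p) pf).
Qed.

(** Comparison of 0 -> Hom_A(C, Q) -> Hom_A(N, Q) -> Hom_A(M, Q) -> 0, after
    base change, with the left exact sequence of the maps from S (x) C,
    S (x) N and S (x) M to S (x) Q. *)
Lemma bc_hom_coker : bijective (bch N) -> bijective (bch C).
Proof.
move=> N_bij.
have [[N_add ext] _ p_surj fp_ex] := fp.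
have [u uK] := precomp_section (ext Q (in_add_refl Q)) MQ_dual.
have [r [rK pruf]] := precomp_retraction p_surj fp_ex uK.
have [_ _ bp_surj bfp] := bc_approx_seq.
apply: inj_surj_bij => [x y xy|h].
  apply/eqP; rewrite -subr_eq0; apply/eqP; rewrite -[LHS](bc_lmapK phi rK).
  rewrite (_ : bc_lmap phi (precomp Q p) _ = 0) ?raddf0 //.
  apply: (bij_inj N_bij); rewrite (zmorph0 (@bc_homB _)); apply: modhomP => z.
  by rewrite bc_hom_precomp bc_homB xy subrr.
have [x xE] := bij_surj N_bij (modhom_fun h \o bc_map phi p).
have fx : bc_lmap phi (precomp Q f) x = 0.
  apply: (bij_inj M_bij); rewrite (zmorph0 (@bc_homB _)); apply: modhomP => z.
  rewrite bc_hom_precomp xE /=.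
  have -> : bcf p (bcf f z) = 0 by apply/bfp; exists z.
  by rewrite raddf0.
exists (bc_lmap phi r x); apply: modhomP => c.
have [y <-] := bp_surj c.
rewrite -[LHS]bc_hom_precomp.
rewrite -[RHS]/(modhom_fun (modhom_fun h \o bc_map phi p : modhom _ _) y) -xE.
by rewrite -[in RHS](bc_lmap_split phi pruf x) fx raddf0 addr0.
Qed.
End Split.
End BaseChangeApprox.

(** * Splitting is local at maximal ideals *)

Lemma maximal_ideal_exists (R : comPzRingType) (I : ideal R) :
  ~ I 1 -> exists m : ideal R, maxspec R m /\ forall x, I x -> m x.
Proof.
move=> I1.
pose proper_over (X : set R) := exists J : ideal R,
  [/\ X = J :> set R, forall x, I x -> J x & ~ J 1].
(* The empty set is the union of the empty chain, hence must be admitted. *)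
have [F FP Ftot|m [mP m_max]] :=
    @Zorn_bigcup R (fun X => X = set0 \/ proper_over X).
  have [[X0 FX0 [y0 X0y]]|F0] := pselect (exists2 X, F X & X !=set0);
    last first.
    left; rewrite -subset0 => x [X FX Xx]; apply: F0; exists X => //.
    by exists x.
  right.
  have FJ X x : F X -> X x -> exists J : ideal R,
      [/\ X = J :> set R, forall x, I x -> J x & ~ J 1].
    by move=> /FP[-> //|].
  have U0 : (\bigcup_(X in F) X) 0.
    by exists X0 => //; have [J [-> _ _]] := FJ _ _ FX0 X0y; exact: ideal0.
  have UD x y : (\bigcup_(X in F) X) x -> (\bigcup_(X in F) X) y ->
      (\bigcup_(X in F) X) (x + y).
    move=> [X FX Xx] [Y FY Yy].
    by case: (Ftot _ _ FX FY) => [XY|YX]; [exists Y => // | exists X => //];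
      [have [J [JE _ _]] := FJ _ _ FY Yy; have := XY _ Xx |
       have [J [JE _ _]] := FJ _ _ FX Xx; have := YX _ Yy];
      move: Xx Yy; rewrite JE => Xx Yy h; apply: idealD.
  have UM r x : (\bigcup_(X in F) X) x -> (\bigcup_(X in F) X) (r * x).
    move=> [X FX Xx]; exists X => //; have [J [JE _ _]] := FJ _ _ FX Xx.
    by move: Xx; rewrite JE; exact: idealM.
  exists (Ideal U0 UD UM); split=> // [x Ix|[X FX X1]].
    have [J [JE IJ _]] := FJ _ _ FX0 X0y.
    by exists X0; rewrite // JE; exact: IJ.
  by have [J [JE _]] := FJ _ _ FX X1; apply; rewrite -JE.
have [J [mE IJ J1]] : proper_over m.
  case: mP => // m0; exfalso; apply: (m_max I); last by right; exists I.
  by rewrite m0; split; [exact: sub0set | move/(_ _ (ideal0 I))].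
exists J; split=> //; split=> // L JL L1 x Lx; apply: contrapT => nJx.
apply: (m_max L); last by right; exists L; split=> // y /IJ; exact: JL.
by rewrite mE; split=> [|LJ]; [exact: JL | exact/nJx/LJ].
Qed.

(** A linear form maps the kernel of U -> U/mU into m. *)
Lemma pure_dual0 (R : comPzRingType) (m : ideal R) (U : lmodType R)
    (l : {linear U -> R^o}) (u : U) :
  pure (rquot_pi m) 1 u = 0 -> m (l u).
Proof.
pose b (s : rquot m) (v : U) : rquot m := s * rquot_pi m (l v).
have bP : balanced (rquot_pi m) b.
  split=> *; rewrite /b ?mulrDl //; first by rewrite raddfD raddfD mulrDr.
  by rewrite linearZ_LR rmorphM mulrA.
move=> u0; have := bc_liftE bP 1 u; rewrite u0 (zmorph0 (bc_lift_additive bP)).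
by rewrite /b mul1r -(rmorph0 (rquot_pi m)) => /esym/rquot_piP; rewrite subr0.
Qed.

(** A retraction of f modulo m lifts to a map V -> U, V being projective. *)
Lemma split_mod_max (R : comPzRingType) (m : ideal R) (U V : lmodType R)
    (f : {linear U -> V})
    (s : {linear bc (rquot_pi m) V -> bc (rquot_pi m) U}) :
  dual_basis V -> cancel (bc_lmap (rquot_pi m) f) s ->
  exists t : {linear V -> U}, forall u,
    pure (rquot_pi m) 1 (t (f u) - u) = 0.
Proof.
move=> [I [e [l lE]]] sK.
have lift (x : bc (rquot_pi m) U) : exists u, x = pure (rquot_pi m) 1 u.
  elim/bc_ind: x => [|x y [u ->] [v ->]|c u].
  - by exists 0; rewrite pure0.
  - by exists (u + v); rewrite pureDr.
  by exists (rquot_repr c *: u); rewrite -pure_bal mul1r; congr (pure _ _ _);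
    exact/esym/rquot_reprK.
have /choice[k kE] i := lift (s (pure (rquot_pi m) 1 (e i))).
have tl : linear (fun v => \sum_i (l i v : R) *: k i).
  move=> c x y; rewrite scaler_sumr -big_split; apply: eq_bigr => i _ /=.
  by rewrite linearP scalerDl scalerA.
have [t tE] := lin_exists tl; exists t => u.
have tf v : pure (rquot_pi m) 1 (t v) = s (pure (rquot_pi m) 1 v).
  rewrite tE [in RHS](lE v) !pure_sum linear_sum; apply: eq_bigr => i _.
  rewrite -!pure_bal !mul1r; set c := (X in pure _ X _ = _).
  have pure1 (W : lmodType R) (w : W) :
      pure (rquot_pi m) c w = c *: pure (rquot_pi m) 1 w.
    by rewrite bc_scale_pure mulr1.
  by rewrite !pure1 linearZ_LR kE.
have H : pure (rquot_pi m) 1 (t (f u)) = pure (rquot_pi m) 1 u.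
  by rewrite tf -bc_lmapE sK.
apply: (addIr (pure (rquot_pi m) 1 u)).
by rewrite -pureDr subrK H add0r.
Qed.

(** An endomorphism e that is the identity modulo m divides some d outside m:
    e is described by the matrix of e + (1 - pi) on R^n, where pi projects R^n
    onto U; this matrix is 1 modulo m, and e' comes from its adjugate. *)
Lemma near_identity (R : comPzRingType) (m : ideal R) (U : lmodType R)
    (e : {linear U -> U}) :
  ~ m 1 -> dual_basis U ->
  (forall (l : {linear U -> R^o}) u, m (l (e u - u))) ->
  exists (d : R) (e' : {linear U -> U}), ~ m d /\ forall u, e' (e u) = d *: u.
Proof.
move=> m1 [I [b0 [l0 lE0]]] em.
pose n := #|I|; pose b (i : 'I_n) := b0 (enum_val i).
pose l (i : 'I_n) := l0 (enum_val i).
have lE u : u = \sum_i l i u *: b i.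
  rewrite [LHS]lE0 (reindex (@enum_val I predT)) //=.
  exact/onW_bij/enum_val_bij.
pose E : 'M[R]_n := \matrix_(i, j) ((i == j)%:R + l i (e (b j) - b j)).
have EE i u : l i (e u) = \sum_j E i j * l j u.
  transitivity (l i u + l i (e u - u)); first by rewrite -raddfD addrC subrK.
  have -> : l i (e u - u) = \sum_j l j u * l i (e (b j) - b j).
    rewrite -[RHS](linear_sumZ (l i)); congr (l i _).
    rewrite [in LHS](lE u) linear_sumZ -sumrB; apply: eq_bigr => j _.
    by rewrite scalerBr.
  rewrite [RHS](eq_bigr (fun j =>
    (i == j)%:R * l j u + l j u * l i (e (b j) - b j))).
    rewrite [RHS]big_split; congr (_ + _).
    rewrite (bigD1 i) //= eqxx mul1r big1 ?addr0 // => j ij.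
    by rewrite eq_sym (negPf ij) mul0r.
  by move=> j _; rewrite mxE mulrDl [X in _ + X]mulrC.
exists (\det E).
have e'l : linear (fun u => \sum_k \sum_i (\adj E k i * l i u) *: b k).
  move=> c x y; rewrite scaler_sumr -big_split; apply: eq_bigr => k _ /=.
  rewrite scaler_sumr -big_split; apply: eq_bigr => i _ /=.
  by rewrite linearP mulrDr scalerDl scalerA mulrCA.
exists (lin e'l); split.
  move=> md; apply: m1.
  have /rquot_piP d1 : rquot_pi m (\det E) = rquot_pi m 1.
    rewrite -det_map_mx rmorph1 -[RHS](@det1 _ n); congr (\det _).
    apply/matrixP => i j; rewrite !mxE rmorphD rmorph_nat -[RHS]addr0.
    congr (_ + _); rewrite -(rmorph0 (rquot_pi m)); apply/rquot_piP.
    by rewrite subr0; exact: em.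
  have -> : 1 = \det E + -1 * (\det E - 1) by rewrite mulN1r opprB addrC subrK.
  by apply: idealD => //; exact: idealM.
move=> u /=; rewrite [in RHS](lE u) scaler_sumr; apply: eq_bigr => k _.
rewrite scalerA -scaler_suml; congr (_ *: _).
transitivity (\sum_j (\adj E *m E) k j * l j u).
  under eq_bigr do rewrite EE mulr_sumr.
  rewrite exchange_big /=; apply: eq_bigr => j _; rewrite mxE mulr_suml.
  by apply: eq_bigr => i _; rewrite mulrA.
rewrite mul_adj_mx (bigD1 k) //= mxE eqxx mulr1n big1 ?addr0 // => j jk.
by rewrite mxE eq_sym (negPf jk) mul0r.
Qed.

Lemma split_local_global (R : comPzRingType) (U V : lmodType R)
    (f : {linear U -> V}) :
  dual_basis U -> dual_basis V ->
  (forall m, maxspec R m ->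
     exists s : {linear bc (rquot_pi m) V -> bc (rquot_pi m) U},
       cancel (bc_lmap (rquot_pi m) f) s) ->
  exists s : {linear V -> U}, cancel f s.
Proof.
move=> dU dV loc.
pose J0 (r : R) := exists s : {linear V -> U}, forall u, s (f u) = r *: u.
have J00 : J0 0 by exists \0 => u; rewrite scale0r.
have J0D x y : J0 x -> J0 y -> J0 (x + y).
  move=> [s sE] [t tE]; exists (s \+ t) => u.
  by rewrite /= sE tE scalerDl.
have J0M r x : J0 x -> J0 (r * x).
  move=> [s sE]; have rl : linear (fun v => r *: s v).
    by move=> c a b; rewrite linearP scalerDr !scalerA mulrC.
  by exists (lin rl) => u; rewrite /= sE scalerA.
suff [s sE] : J0 1 by exists s => u; rewrite sE scale1r.
apply: contrapT => nJ1.
have [m [m_max Jm]] := @maximal_ideal_exists R (Ideal J00 J0D J0M) nJ1.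
have [s sK] := loc m m_max.
have [t tE] := split_mod_max dV sK.
have [|d [e' [md e'E]]] := near_identity (e := t \o f) m_max.1 dU.
  by move=> l u; apply: pure_dual0; exact: tE.
by apply/md/Jm; exists (e' \o t) => u; exact: e'E.
Qed.

(** * Dominant dimension and reduction at maximal ideals *)

Lemma rquot_noetherian (R : comPzRingType) (m : ideal R) :
  noetherian R -> noetherian (rquot m).
Proof.
move=> R_noeth I.
have J0 : I (rquot_pi m 0) by rewrite rmorph0; exact: ideal0.
have JD x y : I (rquot_pi m x) -> I (rquot_pi m y) -> I (rquot_pi m (x + y)).
  by rewrite rmorphD; exact: idealD.
have JM r x : I (rquot_pi m x) -> I (rquot_pi m (r * x)).
  by rewrite rmorphM; exact: idealM.
have [n [g gE]] :=
  R_noeth (Ideal (ideal_set := fun x => I (rquot_pi m x)) J0 JD JM).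
exists n, (fun i => rquot_pi m (g i)) => x; rewrite -[x in I x]rquot_reprK.
split=> [/gE[c cE]|[c cE]].
  exists (fun i => rquot_pi m (c i)); rewrite -[LHS]rquot_reprK cE rmorph_sum.
  by apply: eq_bigr => i _; rewrite rmorphM.
rewrite rquot_reprK (_ : x = rquot_pi m (\sum_i rquot_repr (c i) * g i)).
  by apply/gE; exists (fun i => rquot_repr (c i)).
rewrite cE rmorph_sum; apply: eq_bigr => i _.
by rewrite rmorphM /= rquot_reprK.
Qed.

(** The map M -> Q^I given by a generating family of Hom_A(M, Q). *)
Lemma generated_approx (R : comPzRingType) (A : algebra R) (Q M : lmodType A) :
  dual_basis (modhom M Q) ->
  exists (N : lmodType A) (f : {linear M -> N}), left_approx Q f.
Proof.
move=> [I [e [l lE]]].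
have fl : linear (fun x => [ffun i => modhom_fun (e i) x] : {ffun I -> Q}).
  by move=> c x y; apply/ffunP => i; rewrite !ffunE linearP.
exists {ffun I -> Q}, (lin fl).
apply: left_approx_of_ext => [|h]; first exact: in_add_ffun.
have kl : linear (fun t : {ffun I -> Q} => \sum_i alg_map A (l i h) *: t i).
  move=> c x y; rewrite scaler_sumr -big_split; apply: eq_bigr => i _ /=.
  by rewrite !ffunE scalerDr !scalerA alg_central.
exists (lin kl) => x /=.
rewrite [LHS](congr1 (fun k => modhom_fun k x) (lE h)) modhom_sumE.
by apply: eq_bigr => i _; rewrite ffunE.
Qed.

Lemma domdim_ge_local_global (R : comPzRingType) (A : algebra R)
    (Q : lmodType A) n :
  dual_basis (res Q) -> dual_basis (modhom Q Q) ->
  (forall m, maxspec R m -> bijective (@bc_hom R _ (rquot_pi m) A Q Q)) ->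
  forall M : lmodType A, dual_basis (res M) -> dual_basis (modhom M Q) ->
  (forall m, maxspec R m -> bijective (@bc_hom R _ (rquot_pi m) A M Q)) ->
  domdim_ge Q M n <-> forall m, maxspec R m ->
    @domdim_ge _ (bc_alg (rquot_pi m) A) (bc_mod (rquot_pi m) Q)
      (bc_mod (rquot_pi m) M) n.
Proof.
move=> dQ dQQ Q_bij; elim: n => [|n IHn] M dM dMQ M_bij; first by split.
have [N [f f_approx]] := generated_approx dMQ.
have [C [p [p_surj fp]]] := coker_exists f.
have [N_add ext] := f_approx.
have [dN dNQ] := add_dual_basis N_add dQ dQQ.
have step : AR_mono f ->
    approx_seq Q f p /\
    (domdim_ge Q C n <-> forall m, maxspec R m ->
      @domdim_ge _ (bc_alg (rquot_pi m) A) (bc_mod (rquot_pi m) Q)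
        (bc_mod (rquot_pi m) C) n).
  move=> f_mono; have fps : approx_seq Q f p by split.
  have [dC dCQ] := coker_dual_basis fps dN dNQ dMQ.
  split=> //; apply: IHn => // m m_max.
  apply: (bc_hom_coker fps dMQ (M_bij m m_max)).
  exact: bc_hom_add N_add (Q_bij m m_max).
split=> [dM1 m m_max|dloc].
  have [fps CE] := step (approx_AR_mono f_approx dM1).
  have dC := domdim_ge_coker fps dM1.
  exists (bc_mod (rquot_pi m) N), (bc_mod (rquot_pi m) C).
  exists (bc_map (rquot_pi m) f), (bc_map (rquot_pi m) p).
  split; first exact: bc_approx_seq fps dMQ (M_bij m m_max).
  exact: CE.1.
have f_mono : AR_mono f.
  have [|s sK] := split_local_global (f := res_map f) dM dN; last by exists s.
  move=> m m_max.
  have bf_approx := bc_left_approx f_approx dMQ (M_bij m m_max).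
  have [s sK] := approx_AR_mono bf_approx (dloc m m_max).
  have sl : linear (s : bc (rquot_pi m) (res N) -> bc (rquot_pi m) (res M)).
    move=> c x y; rewrite -!(@bc_str_scale _ _ (rquot_pi m) A).
    exact: (linearP s).
  by exists (lin sl) => x; exact: sK.
have [fps CE] := step f_mono.
exists N, C, f, p; split=> //; apply/CE => m m_max.
apply: (domdim_ge_coker (bc_approx_seq fps dMQ (M_bij m m_max))).
exact: dloc.
Qed.

Theorem theorem3p2p5 (R : comPzRingType) (A : algebra R) (Q M : lmodType A)
    (R_noeth : noetherian R)
    (A_proj : fgproj (reg A))
    (Q_fg : fin_gen Q) (Q_proj : fgproj (res Q))
    (Q_bc : base_change_property Q)
    (M_fg : fin_gen M) (M_proj : fgproj (res M))
    (MQ_proj : fgproj (modhom M Q))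
    (MQ_bc : forall m : ideal R, maxspec R m ->
       bijective (@bc_hom R (rquot m) (rquot_pi m) A M Q)) :
  domdim Q M =
  infimum +oo%E
    [set @domdim (rquot m) (bc_alg (rquot_pi m) A)
           (bc_mod (rquot_pi m) Q) (bc_mod (rquot_pi m) M)
       | m in maxspec R].
Proof.
have [QQ_proj QQ_bc] := Q_bc.
have ge_iff n := domdim_ge_local_global n (fgproj_dual_basis Q_proj)
  (fgproj_dual_basis QQ_proj)
  (fun m _ => QQ_bc _ (rquot_pi m) (rquot_noetherian R_noeth))
  (fgproj_dual_basis M_proj) (fgproj_dual_basis MQ_proj) MQ_bc.
apply: (threshold_inj (domdim_ge_down_closed Q M) (domdim_threshold Q M)).
rewrite (_ : domdim_ge Q M = fun n => forall m, maxspec R m ->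
    @domdim_ge _ (bc_alg (rquot_pi m) A) (bc_mod (rquot_pi m) Q)
      (bc_mod (rquot_pi m) M) n); last by apply/funext => n; apply/propext.
apply: infimum_threshold => m m_max; split; first exact: domdim_ge_down_closed.
exact: domdim_threshold.
Qed.
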